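(* Let $\alpha$ and $\beta$ be fixed real numbers with $\alpha$ positive, irrational, and of finite type. Then there is a constant $\kappa>0$ such that for all integers $N\geqslant 1$ and all integers $0\leqslant a<q\leqslant N^{\kappa}$ with $\gcd(a,q)=1$ we have $$\sum_{\substack{n\leqslant N\\ \lfloor \alpha n+\beta\rfloor\equiv a \pmod q}}\Lambda\bigl(\lfloor \alpha n+\beta\rfloor\bigr)=\alpha^{-1}\sum_{\substack{m\leqslant \lfloor \alpha N+\beta\rfloor\\ m\equiv a\pmod q}}\Lambda(m)+O\bigl(N^{1-\kappa}\bigr),$$ where the implied constant depends only on $\alpha$ and $\beta$.
   Context: The type of an irrational number $\alpha$ is $\tau=\sup\{\varrho\in\mathbb{R} : \liminf_{n\to\infty,\,n\in\mathbb{N}} n^{\varrho}\|\alpha n\|=0\}$, where $\|x\|$ is the distance from $x$ to the nearest integer; $\alpha$ is of finite type if $\tau<\infty$. $\Lambda$ is the von Mangoldt function: $\Lambda(n)=\log p$ if $n$ is a power of a prime $p$, and $\Lambda(n)=0$ otherwise (in particular $\Lambda(n)=0$ for $n\leqslant 1$). Sums over $n\leqslant N$ and $m\leqslant M$ range over positive integers. $\lfloor x\rfloor$ is the greatest integer $\leqslant x$. *)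

(* Defs.v *)
From mathcomp Require Import all_boot all_order all_algebra.
From mathcomp Require Import all_classical all_reals all_analysis.

Set Implicit Arguments.
Unset Strict Implicit.
Unset Printing Implicit Defensive.

Import Order.TTheory GRing.Theory Num.Theory.
Import numFieldNormedType.Exports.

Local Open Scope classical_set_scope.
Local Open Scope ring_scope.

Definition dist_int (R : realType) (x : R) : R :=
  inf [set `|x - z%:~R| | z in [set: int]].

(* The limit inferior is taken in the extended reals because the sequence is
   unbounded for large rho; the term of index 0 does not affect it. *)
Definition diophantine_type (R : realType) (alpha : R) : \bar R :=
  ereal_sup [set rho%:E | rho in [set rho : R |
    limn_einf (fun n : nat =>
      (n%:R `^ rho * dist_int (alpha * n%:R))%:E) = 0%E]].

Definition finite_type (R : realType) (alpha : R) : Prop :=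
  (diophantine_type alpha < +oo)%E.

(* The bounds p <= n and k <= n lose nothing, as p <= p ^ k and k < p ^ k for
   p prime and k > 0; such a p is unique. *)
Definition vonMangoldt (R : realType) (z : int) : R :=
  if z is Posz n then
    if [pick p : 'I_n.+1 |
          prime p && [exists k : 'I_n.+1, (0 < k)%N && (n == p ^ k)%N]]
    is Some p then ln p%:R else 0
  else 0.

(* Main.v *)
(* Grouping by the value m = floor (alpha n + beta), the number of n attached to
   m is 1 / alpha + {g m + s'} - {g m + s} with g = - 1 / alpha, up to boundary
   terms, so the theorem is a discrepancy estimate for g m weighted by the von
   Mangoldt function on a residue class. Fejer kernels on a finite grid reduce it to
   exponential sums over primes at k g + b / q, which Vaughan's identity splits
   into linear and bilinear sums. Since alpha is of finite type,
   |1 - z ^ n| >= c / (n ^ t P ^ s) for the phases z involved, where P is the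
   integer part of N ^ kappa. If kappa is small enough, the truncation
   parameters of Vaughan's identity can be small powers of P: the linear sums
   are then trivially bounded, and after Cauchy-Schwarz the bilinear ones
   follow from the spacing of the powers of z, without Diophantine
   approximation of the frequency. *)

Require Import Defs.
From mathcomp Require Import all_boot all_order all_algebra.
From mathcomp Require Import all_classical all_reals all_analysis.
From mathcomp Require Import complex ring lra zify.

Set Implicit Arguments.
Unset Strict Implicit.
Unset Printing Implicit Defensive.

Import Order.TTheory GRing.Theory Num.Theory.
Import numFieldNormedType.Exports.

Local Open Scope ring_scope.
Local Open Scope complex_scope.

(** The two sides carry the same weights, so the main term is subtracted term by term and only the
    fluctuation of [frac] is weighed. Logarithms from trivial bounds are affordable: [X] is at most
    a constant times [P ^ A], hence the fourth power of [1 + ln X] is at most a constant times [P],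
    and every exponent is chosen with such a reserve. The residue class costs a power of [P] as
    well: for z = e(b / q) e(- k / alpha) the power (z ^ n) ^ q no longer sees b, and |1 - z ^ (n
    q)| <= q |1 - z ^ n| carries the Diophantine bound at k n q over to z. The required saving is
    fixed first. Regularizing the jump of the sawtooth at scale [P ^- 2] makes the Lipschitz
    constant [P ^ 2]; a Fejer kernel of length [P ^ 8] then resolves it, and each exponential sum,
    multiplied by that length, must save [P ^ 9]. Only afterwards is [A] taken so large that
    [P ^ A <= X] yields this saving, and kappa is 1 / [A]. *)

Notation normc := ComplexField.Normc.normc.

(** * Complex modulus and geometric sums *)

Section ComplexModulus.
Variable R : realType.
Implicit Types (z w : R[i]) (x : R).

Lemma normcE z : normc z = Num.sqrt (complex.Re z ^+ 2 + complex.Im z ^+ 2).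
Proof. by case: z. Qed.

Lemma normc_ge0 z : 0 <= normc z.
Proof. by rewrite normcE sqrtr_ge0. Qed.

Lemma normcD z w : normc (z + w) <= normc z + normc w.
Proof. exact: (@le_normcD R z w). Qed.

Lemma normcN z : normc (- z) = normc z.
Proof. by case: z => a b; rewrite !normcE /= !sqrrN. Qed.

Lemma normcB z w : normc (z - w) = normc (w - z).
Proof. by rewrite -normcN opprB. Qed.

Lemma normc0 : normc (0 : R[i]) = 0.
Proof. exact: ComplexField.Normc.normc0. Qed.

Lemma normc1 : normc (1 : R[i]) = 1.
Proof. exact: ComplexField.Normc.normc1. Qed.

Lemma normcM z w : normc (z * w) = normc z * normc w.
Proof. exact: ComplexField.Normc.normcM. Qed.

Lemma normcX z n : normc (z ^+ n) = normc z ^+ n.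
Proof. by elim: n => [|n IH]; rewrite ?expr0 ?normc1 // !exprS normcM IH. Qed.

Lemma normc_conj z : normc z^* = normc z.
Proof. by case: z => a b; rewrite !normcE /= sqrrN. Qed.

Lemma normc_real x : normc x%:C = `|x|.
Proof. by rewrite normcE /= expr0n addr0 sqrtr_sqr. Qed.

Lemma normc_mul_conj z : z * z^* = (normc z ^+ 2)%:C.
Proof.
case: z => a b; rewrite normcE sqr_sqrtr ?addr_ge0 ?sqr_ge0 //=.
by apply/eqP; rewrite eq_complex /=; apply/andP; split; apply/eqP; ring.
Qed.

Lemma Re_le_normc z : `|complex.Re z| <= normc z.
Proof.
rewrite normcE -sqrtr_sqr ler_sqrt ?lerDl ?sqr_ge0 //.
by rewrite addr_ge0 ?sqr_ge0.
Qed.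

Lemma Re_sum (I : Type) (r : seq I) (f : I -> R[i]) :
  complex.Re (\sum_(i <- r) f i) = \sum_(i <- r) complex.Re (f i).
Proof. by apply: (big_morph _ _ (erefl _)) => u v; case: u; case: v. Qed.

Lemma normc_sum (I : Type) (r : seq I) (p : pred I) (F : I -> R[i]) :
  normc (\sum_(i <- r | p i) F i) <= \sum_(i <- r | p i) normc (F i).
Proof.
elim/big_rec2: _ => [|i y z _ h]; first by rewrite normc0.
by apply: le_trans (normcD _ _) _; rewrite lerD2l.
Qed.

Lemma unit_mul_conj z : normc z = 1 -> z * z^* = 1.
Proof. by move=> h; rewrite normc_mul_conj h expr1n. Qed.

(** With [n] equal to the modulus q, this removes a q-th root of unity from a phase at the cost of a
    factor q. *)
Lemma normc_expB1_le z n : normc z = 1 -> normc (1 - z ^+ n) <= n%:R * normc (1 - z).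
Proof.
move=> hz; elim: n => [|n IH]; first by rewrite expr0 subrr normc0 mul0r.
have -> : 1 - z ^+ n.+1 = (1 - z ^+ n) + z ^+ n * (1 - z) by rewrite exprSr; ring.
apply: le_trans (normcD _ _) _; rewrite normcM normcX hz expr1n mul1r.
by rewrite -[n.+1]addn1 natrD mulrDl mul1r lerD2r.
Qed.

(** The product form stays true at z = 1; division happens later, where a lower bound for the chord
    is known. *)
Lemma geometric_sum_bound z (a b : nat) : normc z = 1 ->
  normc (1 - z) * normc (\sum_(a <= l < b) z ^+ l) <= 2.
Proof.
move=> hz; rewrite -normcM.
have [hab|hab] := leqP a b; last by rewrite big_geq ?mulr0 ?normc0 // ltnW.
have -> : (1 - z) * \sum_(a <= l < b) z ^+ l = z ^+ a - z ^+ b.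
  rewrite big_distrr /= (@telescope_sumr_eq _ _ _ (fun l => - z ^+ l)) //.
    by rewrite opprK addrC.
  by move=> l _; rewrite exprS; ring.
apply: le_trans (normcD _ _) _.
by rewrite normcN !normcX hz !expr1n.
Qed.

Lemma root_unity_sum z n : z ^+ n = 1 -> z != 1 -> \sum_(b < n) z ^+ b = 0.
Proof.
move=> zn z1; have h := subrX1 z n; rewrite zn subrr in h.
by move/esym/eqP: h; rewrite mulf_eq0 subr_eq0 (negPf z1) /= => /eqP.
Qed.

End ComplexModulus.

(** * The additive character and lower bounds for chords *)

Section UnitCircle.
Variable R : realType.
Implicit Types x y : R.

Definition expi x : R[i] := cos (2 * pi * x) +i* sin (2 * pi * x).

Lemma normc_expi x : normc (expi x) = 1.
Proof. by rewrite normcE /= cos2Dsin2 sqrtr1. Qed.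

Lemma expiD x y : expi (x + y) = expi x * expi y.
Proof.
rewrite /expi mulrDr cosD sinD; apply/eqP; rewrite eq_complex /=.
by apply/andP; split; apply/eqP; ring.
Qed.

Lemma expi0 : expi 0 = 1.
Proof. by rewrite /expi mulr0 cos0 sin0. Qed.

Lemma expiN x : expi (- x) = (expi x)^*.
Proof. by rewrite /expi mulrN cosN sinN. Qed.

Lemma expi1 : expi 1 = 1.
Proof. by rewrite /expi mulr1 mulr_natl cos2pi sin2pi. Qed.

Lemma expi_mulrn x n : expi (x * n%:R) = expi x ^+ n.
Proof.
elim: n => [|n IH]; first by rewrite mulr0 expi0.
by rewrite -[n.+1]addn1 natrD mulrDr mulr1 expiD IH addn1 exprSr.
Qed.

Lemma expi_int (k : int) : expi k%:~R = 1.
Proof.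
have hn (n : nat) : expi n%:R = 1 by rewrite -[n%:R]mul1r expi_mulrn expi1 expr1n.
by case: k => n; rewrite ?NegzE ?mulrNz ?expiN hn ?conjc1.
Qed.

(** By the mean value theorem and the decrease of the cosine, sin (x / 2) is at least (x / 2) cos (x
    / 2); doubling the angle gives sin x >= x cos (x / 2) ^ 2 = x (1 + cos x) / 2, and cos x >=
    0. *)
Lemma sin_ge_half x : 0 <= x <= pi / 2 -> x / 2 <= sin x.
Proof.
move=> /andP[x0 xpi].
have pi0 : (0 : R) < pi := pi_gt0 R.
have [y0 ypi] : 0 <= x / 2 /\ x / 2 <= pi / 4 by split; lra.
have [c cI hc] := @MVT_segment R sin cos 0 (x / 2) y0
  (fun z _ => is_derive_sin z) (continuous_subspaceT (@continuous_sin R)).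
move: cI hc; rewrite in_itv /= sin0 !subr0 => /andP[c0 cx] hc.
have cosc : cos (x / 2) <= cos c.
  have [-> //|ne] := eqVneq c (x / 2).
  apply: ltW; rewrite ltr_cos ?in_itv /=; [by rewrite lt_neqAle ne cx| |];
  apply/andP; split; lra.
have cosy : 0 <= cos (x / 2) by apply: cos_ge0_pihalf; apply/andP; split; lra.
have cosx : 0 <= cos x by apply: cos_ge0_pihalf; apply/andP; split; lra.
have e : x = x / 2 + x / 2 by lra.
have s2 : sin x = 2 * (sin (x / 2) * cos (x / 2)) by rewrite {1}e sinD; ring.
have c2 : cos x = 2 * cos (x / 2) ^+ 2 - 1.
  by rewrite {1}e cosD; have := cos2Dsin2 (x / 2); nra.
have : x / 2 * cos (x / 2) * cos (x / 2) <= sin (x / 2) * cos (x / 2).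
  by apply: ler_wpM2r => //; rewrite hc mulrC ler_wpM2r.
by rewrite s2; nra.
Qed.

Lemma normc_1B_expi x : normc (1 - expi x) = 2 * `|sin (pi * x)|.
Proof.
rewrite normcE /=.
have -> : (1 - cos (2 * pi * x)) ^+ 2 + (0 - sin (2 * pi * x)) ^+ 2
  = (2 * `|sin (pi * x)|) ^+ 2.
  rewrite exprMn real_normK ?num_real //.
  have -> : 2 * pi * x = pi * x + pi * x by ring.
  by rewrite cosD sinD; have := cos2Dsin2 (pi * x); nra.
by rewrite sqrtr_sqr ger0_norm // mulr_ge0.
Qed.

Lemma chord_ge x : 0 <= x <= 1 -> Num.min x (1 - x) <= normc (1 - expi x).
Proof.
move=> /andP[x0 x1]; rewrite normc_1B_expi.
have pi0 : (0 : R) < pi := pi_gt0 R.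
have pi2 : (2 : R) <= pi by exact: pi_ge2.
have hs y : 0 <= y <= 1 / 2 -> y <= 2 * `|sin (pi * y)|.
  move=> /andP[y0 y1]; have := @sin_ge_half (pi * y).
  have -> : 0 <= pi * y <= pi / 2 by apply/andP; split; nra.
  move=> /(_ isT) h; have := ler_norm (sin (pi * y)); nra.
have [h|h] := lerP x (1 / 2).
  by apply: le_trans (hs _ _); rewrite ?ge_min ?lexx ?x0.
have -> : sin (pi * x) = sin (pi * (1 - x)).
  by rewrite mulrBr mulr1 addrC sinDpi sinN opprK.
by apply: le_trans (hs _ _); rewrite ?ge_min ?lexx ?orbT //; apply/andP; split; lra.
Qed.

Lemma chord_ge_dist (c x : R) : (forall k : int, c <= `|x - k%:~R|) ->
  c <= normc (1 - expi x).
Proof.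
move=> h; pose u := x - (Num.floor x)%:~R.
have u01 : 0 <= u <= 1.
  by rewrite /u subr_ge0 floor_le lerBlDl ltW // -intrD1 lt_succ_floor.
have -> : expi x = expi u.
  by rewrite /u expiD expiN expi_int conjc1 mulr1.
apply: le_trans (chord_ge u01).
have h1 := h (Num.floor x); have h2 := h (Num.floor x + 1).
rewrite -/u ger0_norm in h1; last by case/andP: u01.
rewrite le_min h1 /=; apply: le_trans h2 _.
rewrite intrD opprD addrA -/u distrC ger0_norm //.
by rewrite subr_ge0; case/andP: u01.
Qed.

Lemma expi_eq1 x : expi x = 1 -> exists k : int, x = k%:~R.
Proof.
move=> h; pose u := x - (Num.floor x)%:~R.
have u01 : 0 <= u < 1.
  by rewrite /u subr_ge0 floor_le ltrBlDl -intrD1 lt_succ_floor.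
have eu : expi u = 1 by rewrite /u expiD expiN expi_int conjc1 mulr1.
exists (Num.floor x); apply/eqP; rewrite -subr_eq0 -/u.
have := @chord_ge u; rewrite eu subrr normc0.
case/andP: u01 => u0 u1; rewrite u0 (ltW u1) => /(_ isT).
by rewrite ge_min => /orP[]; lra.
Qed.

End UnitCircle.

(** * Divisor sums and the Moebius and von Mangoldt functions *)

Section DivisorSums.
Variable V : zmodType.

(** The vanishing of [F] above [X] replaces the cut-off [X / d]: the cofactor then has the same
    range for every [d], and sums can be exchanged freely. *)
Lemma sum_multiples (F : nat -> V) (d X : nat) : (0 < d)%N ->
  (forall m, (X < m)%N -> F m = 0) ->
  \sum_(1 <= m < X.+1 | (d %| m)%N) F m = \sum_(1 <= e < X.+1) F (d * e)%N.
Proof.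
move=> d0 hF.
have -> : \sum_(1 <= e < X.+1) F (d * e)%N =
  \sum_(1 <= e < X.+1) \sum_(1 <= m < X.+1 | m == (d * e)%N) F m.
  apply: eq_big_nat => e /andP[e1 eX]; rewrite big_nat1_eq.
  case: ifP => // /negbT; rewrite muln_gt0 d0 e1 /= -leqNgt => h.
  by rewrite hF.
rewrite (exchange_big_dep_nat xpredT) //= big_mkcond /=.
apply: eq_big_nat => m /andP[m1 mX].
have [/dvdnP[e me]|ndm] := boolP (d %| m)%N.
  rewrite (eq_bigl (fun i => i == e)) => [|i]; last first.
    by rewrite me mulnC eqn_pmul2l // eq_sym.
  rewrite big_nat1_eq ifT //; move: m1 mX; rewrite me muln_gt0 => /andP[-> _].
  by move=> /= h; apply: leq_ltn_trans h; rewrite leq_pmulr.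
rewrite big_pred0 // => i; apply: contraNF ndm => /eqP ->.
exact: dvdn_mulr.
Qed.

End DivisorSums.

Section Moebius.
Variable R : numDomainType.

(** At 0 the value is 1, because [primes 0] is empty; the sums over divisors start at 1. *)
Definition mu (n : nat) : R :=
  if all (fun p => logn p n == 1%N) (primes n)
  then (-1) ^+ size (primes n) else 0.

Lemma mu_norm_le1 n : `|mu n| <= 1.
Proof.
rewrite /mu; case: ifP => _; last by rewrite normr0.
by rewrite normrX normrN1 expr1n.
Qed.

Lemma mu_mul_prime p d : prime p -> (0 < d)%N -> ~~ (p %| d)%N ->
  mu (p * d) = - mu d.
Proof.
move=> pp d0 npd; have p0 := prime_gt0 pp.
have hp : perm_eq (primes (p * d)) (p :: primes d).
  apply: uniq_perm; rewrite ?primes_uniq //=.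
    by rewrite mem_primes (negPf npd) !andbF primes_uniq.
  by move=> q; rewrite primesM // primes_prime // !inE.
rewrite /mu (perm_all _ hp) (perm_size hp) /= lognM //.
rewrite logn_prime // eqxx (_ : logn p d = 0%N) /=; last first.
  by apply/eqP; rewrite -leqn0 leqNgt logn_gt0 mem_primes (negPf npd) !andbF.
have -> : all (fun q => logn q (p * d) == 1%N) (primes d) =
          all (fun q => logn q d == 1%N) (primes d).
  apply: eq_in_all => q; rewrite mem_primes => /and3P[pq _ qd].
  rewrite lognM // logn_prime //; case: (q =P p) => // pq'.
  by move: npd; rewrite -pq' qd.
by rewrite exprS mulN1r; case: ifP; rewrite ?oppr0.
Qed.

Lemma mu_sq p d : prime p -> (0 < d)%N -> (p ^ 2 %| d)%N -> mu d = 0.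
Proof.
move=> pp d0; rewrite pfactor_dvdn // => h.
rewrite /mu ifF //; apply/negbTE/allPn; exists p; last by rewrite gtn_eqF.
by rewrite -logn_gt0 (leq_trans _ h).
Qed.

(** With p the least prime factor of n, the divisors p m with p not dividing m cancel the divisors m
    prime to p, and multiples of p ^ 2 contribute 0. *)
Lemma sum_mu n : (0 < n)%N ->
  \sum_(1 <= d < n.+1 | (d %| n)%N) mu d = (n == 1%N)%:R.
Proof.
move=> n0; have [->|n1] := eqVneq n 1%N.
  by rewrite big_mkcond big_nat1 dvdnn /mu /=.
pose p := pdiv n.
have pp : prime p by rewrite pdiv_prime // ltn_neqAle eq_sym n1.
have pn : (p %| n)%N := pdiv_dvd n.
rewrite (bigID (fun d => (p %| d)%N)) /= [X in X + _ = _](_ : _ =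
  - \sum_(1 <= d < n.+1 | (d %| n)%N && ~~ (p %| d)%N) mu d) ?addNr //.
pose F m : R := if (m %| n)%N && (0 < m)%N then mu m else 0.
transitivity (\sum_(1 <= m < n.+1 | (p %| m)%N) F m).
  rewrite [LHS]big_mkcond [RHS]big_mkcond /=.
  apply: eq_big_nat => m /andP[m0 _]; rewrite /F m0 andbT.
  by case: (m %| n)%N; case: (p %| m)%N.
rewrite sum_multiples ?prime_gt0 //; last first.
  by move=> m mn; rewrite /F; case: ifP => // /andP[/dvdn_leq]; lia.
rewrite -sumrN [RHS]big_mkcond /=.
apply: eq_big_nat => m /andP[m0 _].
rewrite /F muln_gt0 prime_gt0 // m0 /= andbT.
have [pm|npm] := boolP (p %| m)%N.
  rewrite andbF; case: ifP => // _.
  by rewrite (@mu_sq p) ?muln_gt0 ?m0 ?andbT ?prime_gt0 // -mulnn dvdn_mul.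
rewrite andbT Gauss_dvd ?pn /= ?prime_coprime //.
by case: ifP => // _; rewrite mu_mul_prime.
Qed.

End Moebius.

Section VonMangoldt.
Variable R : realType.

Definition Lam (n : nat) : R := vonMangoldt R n%:Z.

Lemma prime_pow_inj p q i j : prime p -> prime q -> (0 < i)%N ->
  (p ^ i = q ^ j)%N -> p = q /\ i = j.
Proof.
move=> pp pq i0 h.
have pqE : p = q.
  have : (p %| q ^ j)%N by rewrite -h dvdn_exp.
  by rewrite Euclid_dvdX // dvdn_prime2 // => /andP[/eqP].
by split=> //; apply/eqP; rewrite -(eqn_exp2l _ _ (prime_gt1 pp)) h -pqE.
Qed.

Lemma Lam_prime_pow p j : prime p -> (0 < j)%N -> Lam (p ^ j) = ln p%:R.
Proof.
move=> pp j0; rewrite /Lam /vonMangoldt.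
case: pickP => [q /andP[pq /existsP[k /andP[k0 /eqP]]]|h].
  by move/(prime_pow_inj pp pq j0) => [pqE _]; rewrite -pqE.
have pj : (p < (p ^ j).+1)%N by rewrite ltnS -{1}[p]expn1 leq_exp2l ?prime_gt1.
have jj : (j < (p ^ j).+1)%N by rewrite ltnS ltnW // ltn_expl ?prime_gt1.
have := h (Ordinal pj); rewrite /= pp /= => /negbT/existsPn/(_ (Ordinal jj)).
by rewrite /= j0 eqxx.
Qed.

Lemma Lam_cases n : Lam n = 0 \/
  exists p j, [/\ prime p, (0 < j)%N, n = (p ^ j)%N & Lam n = ln p%:R].
Proof.
rewrite /Lam /vonMangoldt.
case: pickP => [q /andP[pq /existsP[k /andP[k0 /eqP e]]]|h]; last by left.
by right; exists q, k.
Qed.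

Lemma ln_nat_ge0 n : 0 <= ln (n%:R : R).
Proof.
case: n => [|n]; first by rewrite ln0.
by rewrite ln_ge0 // ler1n.
Qed.

Lemma ler_ln_nat m n : (m <= n)%N -> ln (m%:R : R) <= ln n%:R.
Proof.
case: m => [|m] h; first by rewrite ln0 // ln_nat_ge0.
by rewrite ler_ln ?posrE ?ltr0n ?ler_nat // (leq_trans _ h).
Qed.

Lemma Lam_ge0 n : 0 <= Lam n.
Proof. by case: (Lam_cases n) => [->//|[p [j [_ _ _ ->]]]]; exact: ln_nat_ge0. Qed.

Lemma Lam_le_ln n : Lam n <= ln n%:R.
Proof.
case: (Lam_cases n) => [->|[p [j [pp j0 -> ->]]]]; first exact: ln_nat_ge0.
by apply: ler_ln_nat; rewrite -{1}[p]expn1 leq_exp2l ?prime_gt1.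
Qed.

(** At most one pair (p, j) contributes. In this form the sum of [Lam] over divisors becomes an
    exchange of summations. *)
Lemma Lam_sumE n k : (0 < k <= n)%N -> Lam k =
  \sum_(0 <= p < n.+1 | prime p) \sum_(1 <= j < n.+1 | k == (p ^ j)%N) ln p%:R.
Proof.
move=> /andP[k0 kn].
case: (Lam_cases k) => [Lk|[q [i [pq i0 kE ->]]]].
  rewrite Lk; symmetry; rewrite big_nat_cond big1 // => p /andP[_ pp].
  rewrite big_nat_cond big1 // => j /andP[/andP[j0 _] /eqP kE].
  by rewrite -(@Lam_prime_pow p j) // -kE.
have qn : (q < n.+1)%N.
  by rewrite ltnS (leq_trans _ kn) // kE -{1}[q]expn1 leq_exp2l ?prime_gt1.
have i_n : (i < n.+1)%N.
  by rewrite ltnS (leq_trans _ kn) // kE ltnW // ltn_expl ?prime_gt1.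
have inner p : prime p -> \sum_(1 <= j < n.+1 | k == (p ^ j)%N) ln p%:R =
   if p == q then ln q%:R else 0 :> R.
  move=> pp; case: eqP => [->|npq].
    rewrite (eq_bigl (fun j => j == i)) ?big_nat1_eq ?i0 ?i_n // => j.
    by rewrite kE eqn_exp2l ?prime_gt1 // eq_sym.
  rewrite big_nat_cond big1 // => j /andP[/andP[j0 _] /eqP e].
  by case: npq; apply: (proj1 (prime_pow_inj pp pq j0 _)); rewrite -e kE.
rewrite (eq_bigr _ inner) -big_mkcondr /= (eq_bigl (fun p => p == q)).
  by rewrite big_nat1_eq /= qn.
by move=> p /=; case: eqP => [->|]; rewrite ?andbF // pq.
Qed.

Lemma ln_factorization n : (0 < n)%N ->
  ln (n%:R : R) = \sum_(0 <= p < n.+1 | prime p) (logn p n)%:R * ln p%:R.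
Proof.
move=> n0; rewrite -{1}(partnT n0) /partn.
rewrite (bigID prime) /= [X in (_ * X)%N]big1 ?muln1; last first.
  by move=> p np; rewrite lognE (negPf np).
suff [] : (0 < (\prod_(0 <= p < n.+1 | prime p) p ^ logn p n)%N)%N /\
  ln ((\prod_(0 <= p < n.+1 | prime p) p ^ logn p n)%N%:R : R) =
  \sum_(0 <= p < n.+1 | prime p) (logn p n)%:R * ln p%:R by [].
elim/big_rec2: _ => [|p x y pp [y0 yE]]; first by rewrite ln1.
have p0 := prime_gt0 pp.
rewrite muln_gt0 expn_gt0 p0 y0; split=> //.
by rewrite natrM lnM ?posrE ?ltr0n ?expn_gt0 ?p0 // natrX lnXn ?ltr0n // yE mulr_natl.
Qed.

Lemma sum_Lam n : (0 < n)%N ->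
  \sum_(1 <= k < n.+1 | (k %| n)%N) Lam k = ln n%:R.
Proof.
move=> n0; rewrite (ln_factorization n0) big_nat_cond.
rewrite (eq_bigr _ (fun k _ => erefl)).
under eq_bigr => k /andP[/andP[k0 kn] _].
  rewrite (@Lam_sumE n k) ?k0 //; over.
rewrite -big_nat_cond (exchange_big_dep prime) //=.
rewrite [LHS]big_nat_cond [RHS]big_nat_cond.
apply: eq_bigr => p /andP[/andP[_ pn] pp].
rewrite (exchange_big_dep xpredT) //=.
(* The multiplicity of p in n is the number of j >= 1 with p ^ j dividing n. *)
have -> : (logn p n)%:R * ln p%:R =
   \sum_(1 <= j < n.+1 | (j < (logn p n).+1)%N) ln p%:R :> R.
  transitivity (\sum_(1 <= j < (logn p n).+1) ln (p%:R : R)).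
    by rewrite sumr_const_nat subSS subn0 mulr_natl.
  by rewrite (big_nat_widen _ _ n.+1) // ltnS ltnW // ltn_logl.
rewrite [RHS]big_mkcond; apply: eq_big_nat => j /andP[j1 jn].
rewrite ltnS -pfactor_dvdn //.
rewrite (eq_bigl (fun k => (p ^ j %| n)%N && (k == (p ^ j)%N))); last first.
  by move=> k; case: eqP => [->|]; rewrite ?andbF ?pp ?andbT.
rewrite big_nat1_cond_eq expn_gt0 prime_gt0 //= ltnS.
case: (boolP (p ^ j %| n)%N) => h; rewrite ?andbF //.
by rewrite (dvdn_leq n0 h).
Qed.

End VonMangoldt.

(** * Vaughan's identity *)

Section VaughanIdentity.
Variable K : comNzRingType.
Variables (a m L F : nat -> K) (X U V : nat).

Definition trunc_conv (l : nat) : K := \sum_(1 <= d < V.+1 | (d %| l)%N) m d.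
Notation c := trunc_conv.

Lemma sum_divisors_widen (G : nat -> K) n Y : (0 < n <= Y)%N ->
  \sum_(1 <= d < n.+1 | (d %| n)%N) G d = \sum_(1 <= d < Y.+1 | (d %| n)%N) G d.
Proof.
move=> /andP[n0 nY]; rewrite (big_nat_widen _ _ Y.+1) //.
apply: eq_bigl => d; rewrite ltnS; case h: (d %| n)%N => //=.
exact: dvdn_leq.
Qed.

Hypothesis V_gt0 : (0 < V)%N.
Hypothesis hF : forall n, (X < n)%N -> F n = 0.
Hypothesis hm : forall n, (0 < n)%N ->
  \sum_(1 <= d < n.+1 | (d %| n)%N) m d = (n == 1%N)%:R.
Hypothesis ha : forall n, (0 < n)%N -> \sum_(1 <= k < n.+1 | (k %| n)%N) a k = L n.

Lemma trunc_conv_small l : (0 < l <= V)%N -> c l = (l == 1%N)%:R.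
Proof. by move=> /[dup] lV /andP[l0 _]; rewrite /c -(sum_divisors_widen _ lV) hm. Qed.

Lemma sum_trunc_conv (P : pred nat) :
  \sum_(1 <= k < X.+1 | P k) a k * (\sum_(1 <= l < X.+1) c l * F (k * l)) =
  \sum_(1 <= d < V.+1) m d * (\sum_(1 <= k < X.+1 | P k)
     a k * \sum_(1 <= e < X.+1) F (d * k * e)).
Proof.
under [RHS]eq_bigr => d _ do rewrite big_distrr /=.
rewrite (exchange_big_dep P) //= [LHS]big_nat_cond [RHS]big_nat_cond.
apply: eq_bigr => k /andP[/andP[k0 kX] Pk].
under [RHS]eq_bigr => d _ do rewrite mulrCA.
rewrite -big_distrr /=; congr (_ * _).
under eq_bigr => l _ do rewrite big_distrl /=.
rewrite (exchange_big_dep xpredT) //=.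
rewrite Pk; apply: eq_big_nat => d /andP[d0 _].
rewrite -big_distrr /= (sum_multiples (F := fun l => F (k * l)%N)) //; last first.
  by move=> l lX; apply: hF; apply: leq_trans lX _; rewrite leq_pmull.
by congr (_ * _); apply: eq_bigr => e _; rewrite mulnA [(k * d)%N]mulnC.
Qed.

Lemma sum_log_conv d : (0 < d)%N ->
  \sum_(1 <= k < X.+1) a k * (\sum_(1 <= e < X.+1) F (d * k * e)) =
  \sum_(1 <= n < X.+1) L n * F (d * n).
Proof.
move=> d0; symmetry.
under eq_big_nat => n /andP[n0 nX].
  rewrite -ha // (@sum_divisors_widen _ _ X) ?n0 // big_distrl /=; over.
rewrite (exchange_big_dep xpredT) //=.
apply: eq_big_nat => k /andP[k0 _].
rewrite -big_distrr /= (sum_multiples (F := fun n => F (d * n)%N)) //; last first.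
  by move=> l lX; apply: hF; apply: leq_trans lX _; rewrite leq_pmull.
by congr (_ * _); apply: eq_bigr => e _; rewrite mulnA.
Qed.

Lemma sum_trunc_conv_split k : (0 < k)%N ->
  \sum_(1 <= l < X.+1) c l * F (k * l) =
  F k + \sum_(1 <= l < X.+1 | (V < l)%N) c l * F (k * l).
Proof.
move=> k0; rewrite (bigID (fun l => (V < l)%N)) /= addrC; congr (_ + _).
rewrite big_nat_cond (eq_bigr (fun l => if l == 1%N then F k else 0)); last first.
  move=> l /andP[/andP[l0 _]]; rewrite -leqNgt => lV.
  rewrite trunc_conv_small ?l0 //; case: eqP => [->|_]; last by rewrite mul0r.
  by rewrite mul1r muln1.
rewrite -big_nat_cond -big_mkcondr /=.
rewrite (eq_bigl (fun l => l == 1%N)).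
  rewrite big_nat1_eq; case: ifP => // hX; rewrite hF //.
  by move: hX; lia.
by move=> l /=; case: eqP => [->|]; rewrite ?andbF // -leqNgt V_gt0.
Qed.

(** The double sum of [a k * c l * F (k * l)] is evaluated in two ways. Since the convolution of [a]
    with 1 is [L], the whole is the logarithmic sum. Since [c] is 1 at 1 and 0 at the other l <=
    [V], its part with k > [U] returns [a k * F k] plus the bilinear tail. *)
Theorem Vaughan_identity :
  \sum_(1 <= n < X.+1) a n * F n =
    \sum_(1 <= n < X.+1 | (n <= U)%N) a n * F n
  + \sum_(1 <= d < V.+1) m d * (\sum_(1 <= n < X.+1) L n * F (d * n))
  - \sum_(1 <= d < V.+1) m d * (\sum_(1 <= k < X.+1 | (k <= U)%N)
      a k * \sum_(1 <= e < X.+1) F (d * k * e))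
  - \sum_(1 <= k < X.+1 | (U < k)%N)
      a k * (\sum_(1 <= l < X.+1 | (V < l)%N) c l * F (k * l)).
Proof.
rewrite -sum_trunc_conv.
have -> : \sum_(1 <= d < V.+1) m d * (\sum_(1 <= n < X.+1) L n * F (d * n)) =
    \sum_(1 <= k < X.+1) a k * (\sum_(1 <= l < X.+1) c l * F (k * l)).
  rewrite (sum_trunc_conv xpredT).
  by apply: eq_big_nat => d /andP[d0 _]; rewrite sum_log_conv.
rewrite [X in _ = _ + X - _ - _](bigID (fun k => (k <= U)%N)) /=.
have -> : \sum_(1 <= k < X.+1 | ~~ (k <= U)%N)
      a k * (\sum_(1 <= l < X.+1) c l * F (k * l)) =
    \sum_(1 <= k < X.+1 | ~~ (k <= U)%N) a k * F k +
    \sum_(1 <= k < X.+1 | (U < k)%N)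
      a k * (\sum_(1 <= l < X.+1 | (V < l)%N) c l * F (k * l)).
  rewrite [X in _ = _ + X](eq_bigl (fun k => ~~ (k <= U)%N)); last first.
    by move=> k; rewrite -ltnNge.
  rewrite -big_split /= big_nat_cond [RHS]big_nat_cond.
  apply: eq_bigr => k /andP[/andP[k0 _] _].
  by rewrite sum_trunc_conv_split // mulrDr.
rewrite (bigID (fun k => (k <= U)%N)) /=.
ring.
Qed.

End VaughanIdentity.

(** * Mean square of the Vaughan coefficients *)

Section TruncConvMeanSquare.
Variable R : realType.
Variables (m : nat -> R) (V : nat).
Hypothesis hm : forall d, `|m d| <= 1.
Notation h := (\sum_(1 <= e < V.+1) (e%:R : R)^-1).

Lemma sum_inv_multiples g : (0 < g)%N ->
  \sum_(1 <= d < V.+1 | (g %| d)%N) (d%:R : R)^-1 <= g%:R^-1 * h.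
Proof.
move=> g0.
pose F d : R := if (d <= V)%N then d%:R^-1 else 0.
have -> : \sum_(1 <= d < V.+1 | (g %| d)%N) (d%:R : R)^-1 =
   \sum_(1 <= d < V.+1 | (g %| d)%N) F d.
  rewrite big_nat_cond [RHS]big_nat_cond.
  by apply: eq_bigr => d /andP[/andP[_]]; rewrite /F ltnS => ->.
rewrite sum_multiples //; last by move=> d dV; rewrite /F leqNgt dV.
rewrite big_distrr /=; apply: ler_sum => e _; rewrite /F.
by case: ifP => _; rewrite ?natrM ?invfM // mulr_ge0 ?invr_ge0.
Qed.

Lemma count_multiples_le t Y : (0 < t)%N ->
  \sum_(1 <= l < Y.+1 | (t %| l)%N) (1 : R) <= Y%:R / t%:R.
Proof.
move=> t0.
have -> : \sum_(1 <= l < Y.+1 | (t %| l)%N) (1 : R) = (Y %/ t)%:R.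
  by rewrite divn_count_dvd natr_sum big_mkcond; apply: eq_bigr => l _; case: ifP.
by rewrite ler_pdivlMr ?ltr0n // -natrM ler_nat leq_trunc_div.
Qed.

(** After opening the square, the multiples of lcm(d, e) up to [Y] number at most [Y] gcd(d, e) / (d
    e). The gcd is one of the summands of [w d e], the sum of the common divisors g. For fixed g the
    sums over d and e are at most h / g each, and the sum of g (h / g) ^ 2 is h ^ 3. *)
Lemma trunc_conv_mean_square Y :
  \sum_(1 <= l < Y.+1) trunc_conv m V l ^+ 2 <= Y%:R * h ^+ 3.
Proof.
pose w d e : R := \sum_(1 <= g < V.+1) (g %| d)%N%:R * (g %| e)%N%:R * g%:R.
apply: (@le_trans _ _ (\sum_(1 <= d < V.+1) \sum_(1 <= e < V.+1)
    Y%:R * (d%:R^-1 * e%:R^-1 * w d e))).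
  have sqE l : trunc_conv m V l ^+ 2 =
     \sum_(1 <= d < V.+1) \sum_(1 <= e < V.+1)
       (if (lcmn d e %| l)%N then m d * m e else 0).
    rewrite expr2 /trunc_conv big_distrl /= big_mkcond; apply: eq_bigr => d _.
    case hd: (d %| l)%N; last by rewrite big1 // => e _; rewrite dvdn_lcm hd.
    rewrite big_distrr /= big_mkcond; apply: eq_bigr => e _.
    by rewrite dvdn_lcm hd.
  under eq_bigr => l _ do rewrite sqE.
  rewrite exchange_big /=; apply: ler_sum_nat => d /andP[d0 dV].
  rewrite exchange_big /=; apply: ler_sum_nat => e /andP[e0 eV].
  apply: (@le_trans _ _ (\sum_(1 <= l < Y.+1 | (lcmn d e %| l)%N) 1)).
    rewrite [leRHS]big_mkcond; apply: ler_sum => l _; case: ifP => // _.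
    apply: le_trans (ler_norm _) _; rewrite normrM -[leRHS]mulr1.
    exact: ler_pM.
  apply: le_trans (count_multiples_le _ _) _; first by rewrite lcmn_gt0 d0 e0.
  rewrite ler_wpM2l //.
  have -> : (lcmn d e)%:R^-1 = d%:R^-1 * e%:R^-1 * (gcdn d e)%:R :> R.
    have h0 : (lcmn d e)%:R * (gcdn d e)%:R = d%:R * e%:R :> R.
      by rewrite -!natrM muln_lcm_gcd.
    have d1 : d%:R != 0 :> R by rewrite pnatr_eq0 -lt0n.
    have e1 : e%:R != 0 :> R by rewrite pnatr_eq0 -lt0n.
    have l1 : (lcmn d e)%:R != 0 :> R by rewrite pnatr_eq0 -lt0n lcmn_gt0 d0 e0.
    rewrite -invfM -h0 invfM -mulrA mulVf ?mulr1 //.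
    by rewrite pnatr_eq0 -lt0n gcdn_gt0 d0.
  rewrite ler_wpM2l ?mulr_ge0 ?invr_ge0 // /w.
  have gV : (0 < gcdn d e < V.+1)%N.
    rewrite gcdn_gt0 d0 /= (leq_ltn_trans _ dV) //.
    exact: dvdn_leq (dvdn_gcdl d e).
  rewrite (bigD1_seq (gcdn d e)) ?mem_index_iota ?iota_uniq //=.
  rewrite dvdn_gcdl dvdn_gcdr !mul1r lerDl.
  by apply: sumr_ge0 => g _; rewrite !mulr_ge0.
apply: (@le_trans _ _ (\sum_(1 <= g < V.+1)
    Y%:R * (g%:R * (\sum_(1 <= d < V.+1 | (g %| d)%N) (d%:R : R)^-1) ^+ 2))).
  under [leRHS]eq_bigr => g _.
    rewrite big_mkcond expr2 big_distrl /= !big_distrr /=.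
    under eq_bigr => d _ do rewrite !big_distrr /=.
    over.
  rewrite /= [leRHS]exchange_big; apply: ler_sum => d _.
  rewrite [leRHS]exchange_big; apply: ler_sum => e _.
  rewrite /w !big_distrr /=; apply: ler_sum => g _.
  case: (g %| d)%N; case: (g %| e)%N; rewrite ?mulr1 ?mul1r ?mulr0 ?mul0r ?mulr0 //.
  by rewrite [g%:R * _]mulrC.
rewrite -big_distrr /= ler_wpM2l // exprS big_distrl /=.
apply: ler_sum_nat => g /andP[g0 _].
have := @sum_inv_multiples g g0; set S := \sum_(1 <= d < _ | _) _ => hS.
have S0 : 0 <= S by apply: sumr_ge0 => d _; rewrite invr_ge0.
have g1 : (0 : R) < g%:R by rewrite ltr0n.
apply: (@le_trans _ _ (g%:R * (g%:R^-1 * h) ^+ 2)).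
  by rewrite ler_wpM2l // lerXn2r // ?nnegrE // (le_trans S0).
have -> : g%:R * (g%:R^-1 * h) ^+ 2 = g%:R^-1 * h ^+ 2.
  by field; rewrite gt_eqF.
by [].
Qed.

Lemma harmonic_le : h <= 1 + ln V%:R.
Proof.
elim: V => [|n IH]; first by rewrite big_geq // ln0 // addr0.
case: n IH => [|n] IH; first by rewrite big_nat1 invr1 ln1 addr0.
rewrite big_nat_recr //=.
have n0 : (0 : R) < n.+1%:R by rewrite ltr0n.
have n1 : (0 : R) < n.+2%:R by rewrite ltr0n.
have n12 : n.+2%:R = n.+1%:R + 1 :> R by rewrite -natr1.
have := @le_ln1Dx R (- n.+2%:R^-1).
have -> : 1 - n.+2%:R^-1 = n.+1%:R / n.+2%:R :> R.
  have h1 (x : R) : x + 1 != 0 -> 1 - (x + 1)^-1 = x / (x + 1) by move=> hx; field.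
  by rewrite n12 h1 // -n12 gt_eqF.
rewrite ln_div ?posrE //.
have : (-1 : R) < - n.+2%:R^-1.
  by rewrite ltrN2 invf_lt1 // ltr1n.
move=> -> /(_ isT) h2; apply: le_trans (lerD IH (lexx _)) _.
by rewrite -addrA lerD2l -lerBrDr addrC -lerBlDr.
Qed.

End TruncConvMeanSquare.

(** * Cauchy-Schwarz and counting of spaced integers *)

Section CauchySchwarz.
Variable R : realType.

Lemma cauchy_schwarz (I : Type) (r : seq I) (x y : I -> R) :
  (\sum_(i <- r) x i * y i) ^+ 2 <= (\sum_(i <- r) x i ^+ 2) * (\sum_(i <- r) y i ^+ 2).
Proof.
have h0 : 0 <= \sum_(i <- r) \sum_(j <- r) (x i * y j - x j * y i) ^+ 2.
  by apply: sumr_ge0 => i _; apply: sumr_ge0 => j _; rewrite sqr_ge0.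
have e : \sum_(i <- r) \sum_(j <- r) (x i * y j - x j * y i) ^+ 2 =
  (\sum_(i <- r) x i ^+ 2) * (\sum_(i <- r) y i ^+ 2)
  + (\sum_(i <- r) y i ^+ 2) * (\sum_(i <- r) x i ^+ 2)
  + (- 2) * ((\sum_(i <- r) x i * y i) * (\sum_(i <- r) x i * y i)).
  rewrite !big_distrl /= big_distrr /= -!big_split /=; apply: eq_bigr => i _.
  rewrite !big_distrr /= -!big_split /=; apply: eq_bigr => j _; ring.
by rewrite e in h0; nra.
Qed.

Lemma cauchy_schwarz_normc (I : Type) (r : seq I) (x : I -> R) (w : I -> R[i]) :
  normc (\sum_(i <- r) (x i)%:C * w i) ^+ 2 <=
  (\sum_(i <- r) x i ^+ 2) * (\sum_(i <- r) normc (w i) ^+ 2).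
Proof.
have h : normc (\sum_(i <- r) (x i)%:C * w i) <= \sum_(i <- r) `|x i| * normc (w i).
  apply: le_trans (normc_sum _ _ _) _; apply: ler_sum => i _.
  by rewrite normcM normc_real.
apply: (@le_trans _ _ ((\sum_(i <- r) `|x i| * normc (w i)) ^+ 2)).
  by rewrite lerXn2r ?nnegrE ?normc_ge0 // (le_trans (normc_ge0 _) h).
apply: le_trans (cauchy_schwarz _ _ _) _.
by rewrite (eq_bigr (fun i => x i ^+ 2)) // => i _; rewrite real_normK ?num_real.
Qed.

(** Division by [G] is injective on such a set and takes values at most [Q %/ G]. *)
Lemma spaced_count (S : pred nat) (G Q : nat) : (0 < G)%N ->
  (forall i j, S i -> S j -> (i < j)%N -> (G <= j - i)%N) ->
  (\sum_(1 <= k < Q.+1 | S k) 1 <= Q %/ G + 1)%N.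
Proof.
move=> G0 hS; rewrite sum1_count -size_filter addn1.
rewrite -(size_map (fun k => k %/ G)%N) -(size_iota 0 (Q %/ G).+1).
apply: uniq_leq_size.
  rewrite map_inj_in_uniq ?filter_uniq ?iota_uniq // => i j.
  rewrite !mem_filter => /andP[Si _] /andP[Sj _] e.
  have lt_aux k l : S k -> S l -> (k %/ G)%N = (l %/ G)%N -> (k < l)%N -> False.
    move=> Sk Sl kl klt; have := hS _ _ Sk Sl klt.
    rewrite (divn_eq k G) (divn_eq l G) kl subnDl.
    by have := ltn_pmod l G0; lia.
  by case: (ltngtP i j) => // lt_ij; [case: (lt_aux i j)|case: (lt_aux j i)].
move=> x /mapP[k]; rewrite mem_filter mem_index_iota => /andP[_ /andP[_ kQ]] ->.
by rewrite mem_iota /= add0n ltnS leq_div2r.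
Qed.

End CauchySchwarz.

(** * Bilinear sums over a dyadic block *)

Section BilinearSum.
Variables (R : realType) (z : R[i]) (a c : nat -> R) (X G : nat) (A Delta : R).
Hypothesis z_unit : normc z = 1.
Hypothesis G_gt0 : (0 < G)%N.
Hypothesis Delta_gt0 : 0 < Delta.
Hypothesis gap : forall n, (0 < n < G)%N -> 2 * Delta < normc (1 - z ^+ n).
Hypothesis a_le : forall k, (k <= X)%N -> `|a k| <= A.

Definition cut_exp n : R[i] := if (n <= X)%N then z ^+ n else 0.
Notation F := cut_exp.

Lemma normc_unit_expB k l : (k <= l)%N ->
  normc (z ^+ k - z ^+ l) = normc (1 - z ^+ (l - k)).
Proof.
move=> kl; have -> : z ^+ k - z ^+ l = z ^+ k * (1 - z ^+ (l - k)).
  by rewrite mulrBr mulr1 -exprD subnKC.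
by rewrite normcM normcX z_unit expr1n mul1r.
Qed.

(** Two powers within [Delta] of z ^ k are within 2 [Delta] of each other, which [gap] permits only
    for exponents at least [G] apart. *)
Lemma close_count k Q :
  \sum_(1 <= l < Q.+1) (normc (z ^+ l - z ^+ k) <= Delta)%R%:R <= Q%:R / G%:R + 1 :> R.
Proof.
pose S l := normc (z ^+ l - z ^+ k) <= Delta.
have hS i j : S i -> S j -> (i < j)%N -> (G <= j - i)%N.
  move=> Si Sj ij; rewrite leqNgt; apply/negP => lt.
  have := @gap (j - i)%N; rewrite subn_gt0 ij lt => /(_ isT).
  rewrite -normc_unit_expB ?(ltnW ij) //.
  have -> : z ^+ i - z ^+ j = (z ^+ i - z ^+ k) + (z ^+ k - z ^+ j) by ring.
  have := normcD (z ^+ i - z ^+ k) (z ^+ k - z ^+ j).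
  by move: Si Sj; rewrite /S [normc (z ^+ k - _)]normcB; lra.
have := spaced_count Q G_gt0 hS; rewrite -(ler_nat R) natr_sum big_mkcond /=.
rewrite (eq_bigr (fun l => (S l)%:R : R)) => [h|l _]; last by case: (S l).
apply: le_trans h _; rewrite natrD lerD2r ler_pdivlMr ?ltr0n //.
by rewrite -natrM ler_nat leq_trunc_div.
Qed.

(** The cut-offs leave an interval of l, on which the product is a geometric progression of ratio w
    = z ^ k times the conjugate of z ^ k', with |1 - w| = |z ^ k' - z ^ k|. Close pairs get the
    trivial bound [K], all others the geometric one. *)
Lemma correlation_bound (K k k' : nat) : (0 < k)%N -> (0 < k')%N ->
  normc (\sum_(K.+1 <= l < (2 * K).+1) F (k * l) * (F (k' * l))^*%C) <=
  K%:R * (normc (z ^+ k' - z ^+ k) <= Delta)%R%:R + 2 / Delta.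
Proof.
move=> k0 k'0.
pose T := minn (X %/ k) (X %/ k'); pose w := z ^+ k * (z ^+ k')^*%C.
have w_unit : normc w = 1 by rewrite normcM normc_conj !normcX z_unit !expr1n mulr1.
have hw : normc (1 - w) = normc (z ^+ k' - z ^+ k).
  have -> : 1 - w = (z ^+ k' - z ^+ k) * (z ^+ k')^*%C.
    by rewrite mulrBl unit_mul_conj // normcX z_unit expr1n.
  by rewrite normcM normc_conj [X in _ * X]normcX z_unit expr1n mulr1.
have -> : \sum_(K.+1 <= l < (2 * K).+1) F (k * l) * (F (k' * l))^*%C =
    \sum_(K.+1 <= l < minn (2 * K).+1 T.+1) w ^+ l.
  rewrite [RHS](@big_nat_widen _ _ _ _ _ (2 * K).+1) ?geq_minl //= [RHS]big_mkcond.
  apply: eq_big_nat => l /andP[_ lK].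
  rewrite leq_min lK ltnS leq_min !leq_divRL // /F ![(l * _)%N]mulnC.
  case: ifP => _; case: ifP => _; rewrite ?conjc0 ?mulr0 ?mul0r //=.
  by rewrite /w exprMn !exprM !rmorphXn.
have [_|far] := lerP (normc (z ^+ k' - z ^+ k)) Delta.
  rewrite mulr1; apply: (@le_trans _ _ K%:R); last first.
    by rewrite lerDl divr_ge0 // ltW.
  apply: le_trans (normc_sum _ _ _) _.
  rewrite (eq_bigr (fun _ => 1)) => [|l _]; last by rewrite normcX w_unit expr1n.
  by rewrite sumr_const_nat ler_nat; lia.
rewrite mulr0 add0r ler_pdivlMr // mulrC.
apply: le_trans (geometric_sum_bound K.+1 (minn (2 * K).+1 T.+1) w_unit).
by rewrite hw ler_wpM2r ?normc_ge0 // ltW.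
Qed.

Variable P : pred nat.

(** Cauchy-Schwarz in l isolates the coefficients [c], known only in mean square. The remaining
    square is opened over k and k', both at most [Q] because k l <= [X] and l > [K], so that the
    inner sum over l is a correlation of two phases. For each k, [close_count] limits the k' for
    which it is large. *)
Lemma bilinear_block (K : nat) (Q := (X %/ K)%N) : (0 < K)%N ->
  normc (\sum_(K.+1 <= l < (2 * K).+1) (c l)%:C *
     \sum_(1 <= k < X.+1 | P k) (a k)%:C * F (k * l)) ^+ 2 <=
  (\sum_(1 <= l < (2 * K).+1) c l ^+ 2) *
  (A ^+ 2 * (Q%:R * (K%:R * (Q%:R / G%:R + 1) + Q%:R * (2 / Delta)))).
Proof.
move=> K0.
apply: le_trans (cauchy_schwarz_normc _ _ _) _.
apply: ler_pM.
- by apply: sumr_ge0 => i _; rewrite sqr_ge0.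
- by apply: sumr_ge0 => i _; rewrite sqr_ge0.
- rewrite [leRHS](@big_cat_nat _ _ _ K.+1) //=; last by lia.
  by rewrite lerDr sumr_ge0 // => i _; rewrite sqr_ge0.
pose b k := if P k then a k else 0.
have b_le k : (k <= X)%N -> `|b k| <= A.
  move=> kX; rewrite /b; case: ifP => _; first exact: a_le.
  by rewrite normr0 (le_trans _ (a_le (leq0n X))).
have wE l : (K < l)%N -> \sum_(1 <= k < X.+1 | P k) (a k)%:C * F (k * l) =
    \sum_(1 <= k < Q.+1) (b k)%:C * F (k * l).
  move=> Kl.
  have QX : (Q < X.+1)%N by rewrite ltnS leq_div.
  rewrite [RHS](@big_nat_widen _ _ _ _ _ X.+1) // big_mkcond [RHS]big_mkcond.
  apply: eq_big_nat => k /andP[k0 kX] /=; rewrite /b ltnS /Q leq_divRL //.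
  case: (P k); last by rewrite mul0r; case: ifP.
  case: ifP => // /negbT h; rewrite /F ifN ?mulr0 //.
  by apply: contra h; apply: leq_trans; rewrite leq_mul2l ltnW // orbT.
have sqE l : (K < l)%N -> normc (\sum_(1 <= k < X.+1 | P k) (a k)%:C * F (k * l)) ^+ 2 =
   complex.Re (\sum_(1 <= k < Q.+1) \sum_(1 <= k' < Q.+1)
     ((b k * b k')%:C * (F (k * l) * (F (k' * l))^*%C))).
  move=> Kl; rewrite wE //.
  have -> : forall w : R[i], normc w ^+ 2 = complex.Re (w * w^*%C).
    by move=> w; rewrite normc_mul_conj.
  congr complex.Re; rewrite rmorph_sum /= big_distrl /=; apply: eq_bigr => k _.
  rewrite big_distrr /=; apply: eq_bigr => k' _.
  rewrite !rmorphM /= (_ : b k' -i* 0 = (b k')%:C); last by rewrite oppr0.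
  by ring.
rewrite (eq_big_nat _ _ (fun l h => sqE l (proj1 (andP h)))).
rewrite -Re_sum; apply: le_trans (ler_norm _) _; apply: le_trans (Re_le_normc _) _.
rewrite exchange_big /=.
have -> : A ^+ 2 * (Q%:R * (K%:R * (Q%:R / G%:R + 1) + Q%:R * (2 / Delta))) =
   \sum_(1 <= k < Q.+1) A ^+ 2 * (K%:R * (Q%:R / G%:R + 1) + Q%:R * (2 / Delta)).
  by rewrite sumr_const_nat subSS subn0 -[RHS]mulr_natl [LHS]mulrCA.
apply: le_trans (normc_sum _ _ _) _; apply: ler_sum_nat => k /andP[k0 kQ].
rewrite exchange_big /=; apply: le_trans (normc_sum _ _ _) _.
have kX : (k <= X)%N by apply: leq_trans (leq_div X K); rewrite -ltnS.
apply: (@le_trans _ _ (A ^+ 2 * \sum_(1 <= k' < Q.+1)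
   (K%:R * (normc (z ^+ k' - z ^+ k) <= Delta)%R%:R + 2 / Delta))).
  rewrite big_distrr /=; apply: ler_sum_nat => k' /andP[k'0 k'Q].
  have k'X : (k' <= X)%N by apply: leq_trans (leq_div X K); rewrite -ltnS.
  rewrite -big_distrr /= normcM normc_real normrM expr2.
  apply: ler_pM => //; rewrite ?mulr_ge0 ?normc_ge0 //.
    by apply: ler_pM => //; exact: b_le.
  exact: correlation_bound.
rewrite ler_wpM2l ?sqr_ge0 // big_split /= -big_distrr /=.
rewrite lerD //; first by rewrite ler_wpM2l // close_count.
by rewrite sumr_const_nat subSS subn0 -[leLHS]mulr_natl.
Qed.

End BilinearSum.

(** * Linear sums, and dyadic assembly of the bilinear sums *)

Section TypeSums.
Variables (R : realType) (z : R[i]) (X : nat).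
Hypothesis z_unit : normc z = 1.
Notation F := (cut_exp z X).

Lemma cut_exp_large n : (X < n)%N -> F n = 0.
Proof. by move=> h; rewrite /cut_exp leqNgt h. Qed.

(** The free starting point [j] is what partial summation with logarithmic weights uses. *)
Lemma linear_tail_bound d j : (0 < d)%N ->
  normc (1 - z ^+ d) * normc (\sum_(j <= e < X.+1) F (d * e)) <= 2.
Proof.
move=> d0.
have -> : \sum_(j <= e < X.+1) F (d * e) =
    \sum_(j <= e < minn X.+1 (X %/ d).+1) (z ^+ d) ^+ e.
  rewrite [RHS](@big_nat_widen _ _ _ _ _ X.+1) ?geq_minl //= [RHS]big_mkcond.
  apply: eq_big_nat => e /andP[_ eX].
  by rewrite leq_min eX ltnS leq_divRL // [(e * d)%N]mulnC /cut_exp exprM.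
by apply: geometric_sum_bound; rewrite normcX z_unit expr1n.
Qed.

Lemma ln_telescope n : ln (n%:R : R) = \sum_(1 <= j < n.+1) (ln j%:R - ln j.-1%:R).
Proof.
elim: n => [|n IH]; first by rewrite big_geq // ln0.
by rewrite big_nat_recr //= -IH; ring.
Qed.

(* Partial summation: [ln n] is a sum of nonnegative increments. *)
Lemma log_linear_bound d : (0 < d)%N ->
  normc (1 - z ^+ d) * normc (\sum_(1 <= n < X.+1) (ln (n%:R : R))%:C * F (d * n))
  <= 2 * ln X%:R.
Proof.
move=> d0.
have -> : \sum_(1 <= n < X.+1) (ln (n%:R : R))%:C * F (d * n) =
   \sum_(1 <= j < X.+1) (ln j%:R - ln j.-1%:R)%:C * \sum_(j <= n < X.+1) F (d * n).
  transitivity (\sum_(1 <= n < X.+1) \sum_(1 <= j < X.+1 | (j <= n)%N)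
      (ln (j%:R : R) - ln j.-1%:R)%:C * F (d * n)).
    apply: eq_big_nat => n /andP[_ nX].
    rewrite ln_telescope rmorph_sum big_distrl /=.
    by rewrite [LHS](@big_nat_widen _ _ _ _ _ X.+1).
  rewrite (exchange_big_dep xpredT) //=; apply: eq_big_nat => j /andP[j1 _].
  by rewrite [in RHS](@big_nat_widenl _ _ _ j 1) // big_distrr.
apply: (@le_trans _ _ (normc (1 - z ^+ d) * \sum_(1 <= j < X.+1)
   (ln j%:R - ln j.-1%:R) * normc (\sum_(j <= n < X.+1) F (d * n)))).
  rewrite ler_wpM2l ?normc_ge0 //; apply: le_trans (normc_sum _ _ _) _.
  apply: ler_sum => j _; rewrite normcM normc_real ger0_norm //.
  by rewrite subr_ge0 ler_ln_nat // leq_pred.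
rewrite ln_telescope !big_distrr /=; apply: ler_sum => j _.
rewrite mulrCA mulrC ler_wpM2r ?linear_tail_bound //.
by rewrite subr_ge0 ler_ln_nat // leq_pred.
Qed.

Variables (a c : nat -> R) (G U V : nat) (A Delta h : R).
Hypothesis G_gt0 : (0 < G)%N.
Hypothesis U_gt0 : (0 < U)%N.
Hypothesis V_gt0 : (0 < V)%N.
Hypothesis Delta_gt0 : 0 < Delta.
Hypothesis h_ge0 : 0 <= h.
Hypothesis gap : forall n, (0 < n < G)%N -> 2 * Delta < normc (1 - z ^+ n).
Hypothesis a_le : forall k, (k <= X)%N -> `|a k| <= A.
Hypothesis c_mean_square : forall Y, \sum_(1 <= l < Y.+1) c l ^+ 2 <= Y%:R * h.

Notation D l := ((c l)%:C * \sum_(1 <= k < X.+1 | (U < k)%N) (a k)%:C * F (k * l)).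

(** The inequalities K Q <= X, V Q <= X and U K <= X turn the bound of [bilinear_block] into one
    that does not depend on [K]. *)
Lemma dyadic_block (B : R) K : 0 <= B ->
  2 * h * A ^+ 2 * X%:R ^+ 2 * (G%:R^-1 + U%:R^-1 + 2 / (V%:R * Delta)) <= B ^+ 2 ->
  (V <= K)%N -> normc (\sum_(K.+1 <= l < (2 * K).+1) D l) <= B.
Proof.
move=> B0 hB VK; have K0 : (0 < K)%N by apply: leq_trans VK.
(* If X <= U K, then k > U and l > K force k l > X, and every term of the block is cut off. *)
have [XUK|UKX] := leqP X (U * K).
  rewrite big_nat_cond big1 ?normc0 // => l /andP[/andP[Kl _] _].
  rewrite big1 ?mulr0 // => k Uk; rewrite cut_exp_large ?mulr0 //.
  by apply: leq_ltn_trans XUK _; rewrite ltn_mul.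
rewrite -(@ler_pXn2r _ 2) ?nnegrE ?normc_ge0 //; apply: le_trans hB.
apply: le_trans (@bilinear_block R z a c X G A Delta z_unit G_gt0 Delta_gt0 gap a_le _ K K0) _.
set Q := (X %/ K)%N.
have gP : (0 : R) < G%:R by rewrite ltr0n.
have uP : (0 : R) < U%:R by rewrite ltr0n.
have vP : (0 : R) < V%:R by rewrite ltr0n.
have QK : K%:R * Q%:R <= X%:R :> R by rewrite -natrM ler_nat mulnC leq_trunc_div.
have QV : V%:R * Q%:R <= X%:R :> R.
  by apply: le_trans QK; rewrite ler_wpM2r // ler_nat.
have KU : U%:R * K%:R <= X%:R :> R by rewrite -natrM ler_nat ltnW.
apply: (@le_trans _ _ (((2 * K)%:R * h) *
  (A ^+ 2 * (Q%:R * (K%:R * (Q%:R / G%:R + 1) + Q%:R * (2 / Delta)))))).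
  apply: ler_wpM2r (c_mean_square _); have D0 := ltW Delta_gt0.
  by rewrite mulr_ge0 ?sqr_ge0 // mulr_ge0 // addr_ge0 // mulr_ge0 //
    ?divr_ge0 // addr_ge0 // divr_ge0.
have -> : (2 * K)%:R * h * (A ^+ 2 * (Q%:R * (K%:R * (Q%:R / G%:R + 1) + Q%:R * (2 / Delta))))
  = (2 * h * A ^+ 2) * (K%:R * Q%:R * (K%:R * Q%:R / G%:R + K%:R + Q%:R * (2 / Delta))).
  by rewrite natrM; ring.
rewrite -[leRHS]mulrA; apply: ler_wpM2l.
  by apply: mulr_ge0; [exact: mulr_ge0|exact: sqr_ge0].
rewrite expr2 -[leRHS]mulrA; apply: ler_pM => //.
  by rewrite !addr_ge0 ?mulr_ge0 ?invr_ge0 // ltW.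
rewrite !mulrDr; apply: lerD; first apply: lerD.
- by rewrite ler_wpM2r ?invr_ge0.
- by rewrite ler_pdivlMr // mulrC.
- have -> : X%:R * (2 / (V%:R * Delta)) = X%:R / V%:R * (2 / Delta).
    by field; rewrite !gt_eqF.
  rewrite ler_wpM2r ?divr_ge0 ?(ltW Delta_gt0) //.
  by rewrite ler_pdivlMr // mulrC.
Qed.

Lemma type_two_bound (B : R) J : 0 <= B ->
  2 * h * A ^+ 2 * X%:R ^+ 2 * (G%:R^-1 + U%:R^-1 + 2 / (V%:R * Delta)) <= B ^+ 2 ->
  (X <= V * 2 ^ J)%N ->
  normc (\sum_(1 <= k < X.+1 | (U < k)%N) (a k)%:C *
    \sum_(1 <= l < X.+1 | (V < l)%N) (c l)%:C * F (k * l)) <= J%:R * B.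
Proof.
move=> B0 hB XJ.
have -> : \sum_(1 <= k < X.+1 | (U < k)%N) (a k)%:C *
    (\sum_(1 <= l < X.+1 | (V < l)%N) (c l)%:C * F (k * l)) =
    \sum_(V.+1 <= l < (V * 2 ^ J).+1) D l.
  transitivity (\sum_(1 <= l < X.+1 | (V < l)%N) D l).
    under eq_bigr => k _ do rewrite big_distrr /=.
    rewrite exchange_big /=; apply: eq_bigr => l _.
    by rewrite big_distrr /=; apply: eq_bigr => k _; rewrite mulrCA.
  transitivity (\sum_(1 <= l < (V * 2 ^ J).+1 | (V < l)%N) D l).
    rewrite [LHS](@big_nat_widen _ _ _ _ _ (V * 2 ^ J).+1) ?ltnS // big_mkcondr.
    rewrite [LHS]big_nat_cond [RHS]big_nat_cond.
    apply: eq_bigr => l /andP[/andP[l0 _] _]; rewrite ltnS.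
    case: leqP => // lX; rewrite big_nat_cond big1 ?mulr0 // => k /andP[/andP[k0 _] _].
    by rewrite cut_exp_large ?mulr0 // (leq_trans lX) // leq_pmull.
  rewrite [LHS](@big_cat_nat _ _ _ V.+1) //=; last by rewrite ltnS leq_pmulr ?expn_gt0.
  rewrite big_nat_cond big1 ?add0r => [|l]; last by lia.
  by rewrite big_nat_cond [RHS]big_nat_cond; apply: eq_bigl => l; lia.
elim: {XJ} J => [|J IH]; first by rewrite muln1 big_geq ?normc0 ?mul0r.
have VJ : (V <= V * 2 ^ J)%N by rewrite leq_pmulr ?expn_gt0.
rewrite expnS mulnCA (@big_cat_nat _ _ _ (V * 2 ^ J).+1) ?ltnS //=; last by lia.
apply: le_trans (normcD _ _) _; rewrite -[J.+1]addn1 natrD mulrDl mul1r.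
by apply: lerD => //; apply: dyadic_block.
Qed.

End TypeSums.

(** * Exponential sums weighted by the von Mangoldt function *)

Section VonMangoldtExpSum.
Variable R : realType.
Implicit Types z : R[i].

Lemma sum_prefix_le (X U : nat) (x : R) : 0 <= x ->
  \sum_(1 <= k < X.+1 | (k <= U)%N) x <= U%:R * x.
Proof.
move=> x0; apply: (@le_trans _ _ (\sum_(1 <= k < (X + U).+1 | (k < U.+1)%N) x)).
  rewrite [leRHS](@big_cat_nat _ _ _ X.+1) //= ?ltnS ?leq_addr //.
  by rewrite lerDl sumr_ge0.
rewrite -(@big_nat_widen _ _ _ _ _ _ xpredT) ?ltnS ?leq_addl //.
by rewrite sumr_const_nat subSS subn0 mulr_natl.
Qed.

(** Two separations are kept apart. The bilinear part needs [Delta] only for exponents below [G],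
    where it must be large against 1 / [V]. The linear sums meet the exponents d k up to [U * V],
    and their [delta] may be much smaller, since it only competes with [X]. *)
Lemma exp_sum_raw z (X U V G J : nat) (Delta delta B : R) :
  normc z = 1 -> (0 < G)%N -> (0 < U)%N -> (0 < V)%N -> 0 < Delta -> 0 < delta ->
  0 <= B ->
  (forall n, (0 < n < G)%N -> 2 * Delta < normc (1 - z ^+ n)) ->
  (forall n, (0 < n <= U * V)%N -> delta <= normc (1 - z ^+ n)) ->
  2 * (1 + ln V%:R) ^+ 3 * ln X%:R ^+ 2 * X%:R ^+ 2 *
    (G%:R^-1 + U%:R^-1 + 2 / (V%:R * Delta)) <= B ^+ 2 ->
  (X <= V * 2 ^ J)%N ->
  normc (\sum_(1 <= n < X.+1) (Lam R n)%:C * z ^+ n) <=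
    U%:R * ln X%:R + V%:R * (2 * ln X%:R / delta)
    + V%:R * (U%:R * (ln X%:R * (2 / delta))) + J%:R * B.
Proof.
move=> z1 G0 U0 V0 D0 d0 B0 gap far hB XJ.
set A := ln X%:R.
have A0 : 0 <= A by exact: ln_nat_ge0.
have LamA k : (k <= X)%N -> `|Lam R k| <= A.
  by move=> kX; rewrite ger0_norm ?Lam_ge0 // (le_trans (Lam_le_ln _ _)) // ler_ln_nat.
have mu1 d : `|mu R d| <= 1 := mu_norm_le1 R d.
have muC1 d : normc (mu R d)%:C <= 1 by rewrite normc_real.
have invle x n : (0 < n <= U * V)%N -> normc (1 - z ^+ n) * x <= 2 -> 0 <= x ->
    x <= 2 / delta.
  move=> nUV hx x0; rewrite ler_pdivlMr // mulrC; apply: le_trans hx.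
  by rewrite ler_wpM2r // far.
have -> : \sum_(1 <= n < X.+1) (Lam R n)%:C * z ^+ n =
    \sum_(1 <= n < X.+1) (Lam R n)%:C * cut_exp z X n.
  by apply: eq_big_nat => n /andP[_ nX]; rewrite /cut_exp -ltnS nX.
rewrite (@Vaughan_identity _ (fun n => (Lam R n)%:C) (fun n => (mu R n)%:C)
  (fun n => (ln n%:R)%:C) (cut_exp z X) X U V) //; first last.
- move=> n n0; rewrite -(sum_Lam R n0) rmorph_sum /=.
  by [].
- move=> n n0; transitivity ((\sum_(1 <= d < n.+1 | (d %| n)%N) mu R d)%:C).
    by rewrite rmorph_sum.
  by rewrite sum_mu //; case: (n == 1%N).
- exact: cut_exp_large.
have normF n : normc (cut_exp z X n) <= 1.
  by rewrite /cut_exp; case: ifP => _; rewrite ?normc0 // normcX z1 expr1n.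
apply: le_trans (normcD _ _) _; rewrite normcN; apply: lerD; last first.
  pose c l := trunc_conv (mu R) V l.
  have cE l : trunc_conv (fun n => (mu R n)%:C) V l = (c l)%:C by rewrite rmorph_sum.
  under eq_bigr => k _ do under eq_bigr => l _ do rewrite cE.
  apply: (@type_two_bound _ z X z1 _ c G U V A Delta ((1 + ln V%:R) ^+ 3)) => //.
    by rewrite exprn_ge0 // addr_ge0 // ln_nat_ge0.
  move=> Y; apply: le_trans (trunc_conv_mean_square V mu1 Y) _.
  rewrite ler_wpM2l // lerXn2r ?nnegrE ?harmonic_le //.
    by apply: sumr_ge0 => e _; rewrite invr_ge0.
  by rewrite addr_ge0 // ln_nat_ge0.
apply: le_trans (normcD _ _) _; rewrite normcN; apply: lerD; last first.
  apply: le_trans (normc_sum _ _ _) _.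
  have -> : V%:R * (U%:R * (A * (2 / delta))) =
     \sum_(1 <= d < V.+1) U%:R * (A * (2 / delta)).
    by rewrite sumr_const_nat subSS subn0 -[RHS]mulr_natl.
  apply: ler_sum_nat => d /andP[d0' dV]; rewrite normcM.
  rewrite -[leRHS]mul1r; apply: ler_pM; rewrite ?normc_ge0 //.
  apply: le_trans (normc_sum _ _ _) _.
  apply: (@le_trans _ _ (\sum_(1 <= k < X.+1 | (k <= U)%N) A * (2 / delta))); last first.
    by apply: sum_prefix_le; rewrite mulr_ge0 // divr_ge0 // ltW.
  rewrite big_nat_cond [leRHS]big_nat_cond.
  apply: ler_sum => k /andP[/andP[k0 kX] kU]; rewrite normcM normc_real.
  apply: ler_pM; rewrite ?normc_ge0 ?LamA //.
  apply: (invle _ (d * k)%N); rewrite ?normc_ge0 ?linear_tail_bound ?muln_gt0 ?d0' ?k0 //.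
  by rewrite mulnC leq_mul.
apply: le_trans (normcD _ _) _; apply: lerD.
  apply: le_trans (normc_sum _ _ _) _; apply: le_trans (sum_prefix_le X U A0).
  rewrite big_nat_cond [leRHS]big_nat_cond.
  apply: ler_sum => k /andP[/andP[k0 kX] kU]; rewrite normcM normc_real -[leRHS]mulr1.
  by apply: ler_pM; rewrite ?normc_ge0 ?LamA.
apply: le_trans (normc_sum _ _ _) _.
have -> : V%:R * (2 * A / delta) = \sum_(1 <= d < V.+1) (2 * A / delta).
  by rewrite sumr_const_nat subSS subn0 -[RHS]mulr_natl.
apply: ler_sum_nat => d /andP[d0' dV]; rewrite normcM -[leRHS]mul1r.
apply: ler_pM; rewrite ?normc_ge0 // ler_pdivlMr // mulrC.
apply: le_trans (log_linear_bound X z1 d0'); rewrite ler_wpM2r ?normc_ge0 // far //.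
by rewrite d0' /= -ltnS (leq_trans dV) // ltnS leq_pmull.
Qed.

(** With r the fourth root of [P], ln P = 4 ln r <= 4 (r - 1), so 1 + ln P <= 4 r; the constant is 4
    ^ 4. *)
Lemma log_fourth_le (P : nat) : (0 < P)%N -> (1 + ln (P%:R : R)) ^+ 4 <= 256 * P%:R.
Proof.
move=> P0; pose r : R := Num.sqrt (Num.sqrt P%:R).
have P1 : (1 : R) <= P%:R by rewrite ler1n.
have r1 : 1 <= r.
  have s1 (x : R) : 1 <= x -> 1 <= Num.sqrt x by move=> h; rewrite -[X in X <= _]sqrtr1 ler_wsqrtr.
  by rewrite /r !s1.
have r4 : P%:R = r ^+ 4.
  by rewrite (exprM r 2 2) /r sqr_sqrtr ?sqrtr_ge0 // sqr_sqrtr.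
have r0 : 0 < r by lra.
have hln : ln r <= r - 1.
  have e : 1 + (r - 1) = r by ring.
  by rewrite -{1}e; apply: le_ln1Dx; lra.
have -> : ln P%:R = 4 * ln r by rewrite r4 lnXn // mulr_natl.
have -> : 256 * P%:R = (4 * r) ^+ 4 by rewrite r4 exprMn -natrX.
have ln0 : 0 <= ln r by rewrite ln_ge0.
rewrite lerXn2r ?nnegrE //; lra.
Qed.

(** The fourth power is the one that occurs below: three logarithms in each dyadic block, and one
    for the number of blocks. *)
Lemma log_fourth_bound (C1 : R) (A P X : nat) : (0 < P)%N ->
  (0 < X)%N -> X%:R <= C1 * P%:R ^+ A ->
  (1 + ln X%:R) ^+ 4 <= (256 * (1 + `|ln C1| + A%:R) ^+ 4) * P%:R.
Proof.
move=> P0 X0 hX.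
have P1 : (0 : R) < P%:R by rewrite ltr0n.
have C0 : 0 < C1.
  have : 0 < C1 * P%:R ^+ A by apply: lt_le_trans hX; rewrite ltr0n.
  by rewrite pmulr_lgt0 // exprn_gt0.
have lnP : 0 <= ln (P%:R : R) := ln_nat_ge0 R P.
have h : 1 + ln (X%:R : R) <= (1 + `|ln C1| + A%:R) * (1 + ln P%:R).
  have : ln (X%:R : R) <= ln C1 + ln P%:R *+ A.
    rewrite -lnXn // -lnM ?posrE ?exprn_gt0 // ler_ln ?posrE ?ltr0n //.
    by rewrite mulr_gt0 // exprn_gt0.
  rewrite -mulr_natl; have := ler_norm (ln C1); have := normr_ge0 (ln C1).
  by have : (0 : R) <= A%:R by []; nra.
apply: (@le_trans _ _ (((1 + `|ln C1| + A%:R) * (1 + ln P%:R)) ^+ 4)).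
  rewrite lerXn2r ?nnegrE ?addr_ge0 ?ln_nat_ge0 //.
  by rewrite (le_trans _ h) // addr_ge0 ?ln_nat_ge0.
rewrite exprMn; set a := (1 + `|ln C1| + _) ^+ 4.
have -> : 256 * a * P%:R = a * (256 * P%:R) by ring.
apply: ler_wpM2l (log_fourth_le P0).
by rewrite exprn_ge0 // !addr_ge0.
Qed.


Lemma dyadic_cover (X : nat) : (0 < X)%N ->
  exists2 J : nat, (X <= 2 ^ J)%N & J%:R <= 2 * (1 + ln (X%:R : R)).
Proof.
move=> X0; exists (trunc_log 2 X).+1; first by rewrite ltnW // trunc_log_ltn.
have ln2 : 1 / 2 <= ln (2 : R).
  have := @le_ln1Dx R (- 2^-1); have -> : 1 - 2^-1 = 2^-1 :> R by lra.
  by rewrite lnV ?posrE // => h; have := h ltac:(lra); lra.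
have h : (trunc_log 2 X)%:R * ln 2 <= ln (X%:R : R).
  rewrite mulr_natl -lnXn // ler_ln ?posrE ?exprn_gt0 ?ltr0n //.
  by rewrite -natrX ler_nat trunc_logP.
by rewrite -natr1; have : (0 : R) <= (trunc_log 2 X)%:R by []; nra.
Qed.

(* Parameters: [U = V = P^u], [G = P^g] with [g = 2w + 4] and [u = g + gt + s]. *)
Lemma exp_sum_long (t s w : nat) : exists A0 : nat,
  forall (c0 C4 : R), 0 < c0 -> exists2 C : R, 0 <= C & forall (P X : nat) z,
    (0 < P)%N -> (P ^ A0 <= X)%N -> (1 + ln X%:R) ^+ 4 <= C4 * P%:R -> normc z = 1 ->
    (forall n, (0 < n)%N -> c0 / (n%:R ^+ t * P%:R ^+ s) <= normc (1 - z ^+ n)) ->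
    normc (\sum_(1 <= n < X.+1) (Lam R n)%:C * z ^+ n) <= C * (X%:R / P%:R ^+ w).
Proof.
have aux (i j k : nat) : (j <= 2 * j + i + 1 + k)%N by lia.
have aux2 (x : R) (i j : nat) : x ^+ (2 * i + j + 1) = x ^+ i * x ^+ i * x ^+ j * x.
  by rewrite (_ : 2 * i + j + 1 = i + i + j + 1)%N ?exprD ?expr1 //; lia.
pose g := (2 * w + 4)%N; pose u := (g + g * t + s)%N.
(* Size of the linear terms: [U * V] contributes [2 * u], the inverse of [delta] contributes
   [2 * u * t + s], and the logarithm one more [P]. They are at most [X / P ^ w] as soon as
   [P ^ (e + w) <= X]. *)
pose e := (2 * u + (2 * u * t + s) + 1)%N.
exists (e + w)%N => c0 C4 c0P.
(* In units of [P ^- g], the terms 1 / G, 1 / U and 2 / (V Delta) are at most 1, 1 and 8 / c0. *)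
pose C' := 2 + 8 / c0.
have C'2 : 2 <= C' by rewrite /C' lerDl divr_ge0 // ltW.
exists ((1 + 4 / c0) * `|C4| + 2 * C' * `|C4|).
  by rewrite addr_ge0 ?mulr_ge0 ?addr_ge0 ?divr_ge0 // ?ltW //; lra.
move=> P X z P0 PX hL z1 hz.
have p0 : (0 : R) < P%:R by rewrite ltr0n.
have p1 : (1 : R) <= P%:R by rewrite ler1n.
have pX k : (0 : R) < P%:R ^+ k by rewrite exprn_gt0.
have X0 : (0 < X)%N by apply: leq_trans PX; rewrite expn_gt0 P0.
set Lg := 1 + ln X%:R in hL.
have lnX0 : 0 <= ln (X%:R : R) := ln_nat_ge0 R X.
have Lg1 : 1 <= Lg by rewrite /Lg lerDl.
have lnLg : ln X%:R <= Lg by rewrite /Lg lerDr.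
have C40 : 0 < C4.
  have : 0 < C4 * P%:R by apply: lt_le_trans hL; rewrite exprn_gt0; lra.
  by rewrite pmulr_lgt0.
rewrite gtr0_norm //.
have [J XJ hJ] := dyadic_cover X0.
(* The hypothesis gives 4 [Delta] for exponents below [P ^ g], which leaves room for the strict
   inequality in [gap]. *)
pose Delta := c0 / (4 * P%:R ^+ (g * t + s)).
pose delta := c0 / P%:R ^+ (2 * u * t + s).
(* The square has denominator [P ^ g] and the factor [Lg ^ 6]. Five logarithms are required, and the
   spare [C' * Lg] absorbs the constant 2. *)
pose B := C' * Lg ^+ 3 * (X%:R / P%:R ^+ (w + 2)).
have c0n : c0 != 0 by rewrite gt_eqF.
have pn k : P%:R ^+ k != 0 :> R by rewrite gt_eqF.
have far n m k : (0 < n <= P ^ m)%N -> (m * t + s = k)%N ->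
    c0 / P%:R ^+ k <= normc (1 - z ^+ n).
  move=> /andP[n0 nm] <-; apply: le_trans (hz _ n0); rewrite ler_wpM2l ?(ltW c0P) //.
  rewrite lef_pV2 ?posrE ?mulr_gt0 ?exprn_gt0 ?ltr0n // exprD ler_wpM2r ?(ltW (pX _)) //.
  by rewrite exprM lerXn2r ?nnegrE ?exprn_ge0 // -natrX ler_nat.
have D0 : 0 < Delta by rewrite divr_gt0 // mulr_gt0.
have d0 : 0 < delta by rewrite divr_gt0.
have B0 : 0 <= B by rewrite /B mulr_ge0 ?divr_ge0 ?exprn_ge0 // mulr_ge0 ?exprn_ge0 //; lra.
have Pu : (0 < P ^ u)%N by rewrite expn_gt0 P0.
have Pg : (0 < P ^ g)%N by rewrite expn_gt0 P0.
have PuX : (P ^ u <= X)%N.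
  apply: leq_trans PX; rewrite leq_pexp2l //.
  exact: aux.
have hB : 2 * (1 + ln (P ^ u)%:R) ^+ 3 * ln X%:R ^+ 2 * X%:R ^+ 2 *
    ((P ^ g)%:R^-1 + (P ^ u)%:R^-1 + 2 / ((P ^ u)%:R * Delta)) <= B ^+ 2.
  have T : (P ^ g)%:R^-1 + (P ^ u)%:R^-1 + 2 / ((P ^ u)%:R * Delta) <= C' / P%:R ^+ g.
    have e1 : 2 / ((P ^ u)%:R * Delta) = 8 / c0 / P%:R ^+ g.
      rewrite natrX /Delta /u -addnA exprD; field.
      by rewrite c0n !pn.
    have e2 : (P ^ u)%:R^-1 <= (P%:R ^+ g)^-1 :> R.
      rewrite natrX lef_pV2 ?posrE //; apply: ler_weXn2l => //.
      by rewrite /u -addnA leq_addr.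
    rewrite e1 natrX /C' [X in _ <= X]mulrDl; lra.
  have lnV : 1 + ln (P ^ u)%:R <= Lg by rewrite lerD2l ler_ln_nat.
  have lnV0 : 0 <= ln ((P ^ u)%:R : R) := ln_nat_ge0 R _.
  have BE : B ^+ 2 = C' * Lg * Lg ^+ 3 * Lg ^+ 2 * X%:R ^+ 2 * (C' / P%:R ^+ g).
    rewrite /B /g; have -> : (2 * w + 4 = (w + 2) + (w + 2))%N by rewrite addnACA addnn mul2n.
    by rewrite [P%:R ^+ (w + 2 + _)]exprD; field; exact: pn.
  rewrite BE; apply: ler_pM T.
  - by rewrite !mulr_ge0 // ?exprn_ge0 ?addr_ge0.
  - have D1 := ltW D0; rewrite !addr_ge0 ?invr_ge0 // divr_ge0 // mulr_ge0 //.
  - apply: ler_wpM2r; first exact: exprn_ge0.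
    apply: ler_pM; rewrite ?exprn_ge0 ?mulr_ge0 ?exprn_ge0 ?addr_ge0 //.
      apply: ler_pM; rewrite ?exprn_ge0 ?addr_ge0 //; first by nra.
      by rewrite lerXn2r ?nnegrE ?addr_ge0 //; lra.
    by rewrite lerXn2r ?nnegrE //; lra.
apply: le_trans (@exp_sum_raw z X (P ^ u) (P ^ u) (P ^ g) J Delta delta B z1 Pg Pu Pu D0 d0 B0 _ _ hB _) _.
- move=> n /andP[n0 nG]; apply: lt_le_trans (far n g _ _ erefl); last by rewrite n0 ltnW.
  rewrite /Delta; have h : 0 < c0 / P%:R ^+ (g * t + s) by rewrite divr_gt0.
  have -> : 2 * (c0 / (4 * P%:R ^+ (g * t + s))) = c0 / P%:R ^+ (g * t + s) / 2.
    by field; exact: pn.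
  by lra.
- move=> n; rewrite -expnD addnn -mul2n => hn; exact: far hn erefl.
- by apply: leq_trans XJ _; rewrite leq_pmull.
have LgC : ln X%:R <= C4 * P%:R by apply: le_trans lnLg _; apply: le_trans hL; exact: ler_eXnr.
pose E := X%:R / P%:R ^+ w : R.
have E0 : 0 <= E by rewrite /E divr_ge0 // ltW.
have eE : P%:R ^+ e <= E.
  by rewrite /E ler_pdivlMr // -exprD -natrX ler_nat.
pose y := P%:R ^+ u : R; pose v := P%:R ^+ (2 * u * t + s) : R.
have eyv : P%:R ^+ e = y * y * v * P%:R.
  exact: aux2.
have y1 : 1 <= y by rewrite /y exprn_ege1.
have v1 : 1 <= v by rewrite /v exprn_ege1.
have ic0 : 0 <= c0^-1 by rewrite invr_ge0 ltW.
have dE : delta^-1 = v * c0^-1 by rewrite /delta invfM invrK mulrC.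
have Cp0 : 0 <= C4 * P%:R by rewrite mulr_ge0 // ltW.
have yv0 : 0 <= y * v by nra.
have h1 : (P ^ u)%:R * ln X%:R <= C4 * E.
  rewrite natrX -/y; apply: (@le_trans _ _ (y * (C4 * P%:R))).
    by rewrite ler_wpM2l //; lra.
  apply: (@le_trans _ _ (C4 * P%:R ^+ e)); last by rewrite ler_wpM2l // ltW.
  rewrite eyv mulrCA ler_wpM2l ?(ltW C40) // ler_wpM2r ?(ltW p0) //.
  by rewrite -mulrA ler_peMr ?mulr_ege1 //; lra.
have h3 : (P ^ u)%:R * ((P ^ u)%:R * (ln X%:R * (2 / delta))) <= 2 / c0 * C4 * E.
  rewrite natrX -/y dE.
  have -> : y * (y * (ln X%:R * (2 * (v / c0)))) = (2 / c0) * (y * y * v) * ln X%:R by ring.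
  apply: (@le_trans _ _ ((2 / c0) * (y * y * v) * (C4 * P%:R))).
    by apply: ler_wpM2l LgC; rewrite !mulr_ge0 //; lra.
  have -> : 2 / c0 * (y * y * v) * (C4 * P%:R) = 2 / c0 * C4 * P%:R ^+ e by rewrite eyv; ring.
  by apply: ler_wpM2l eE; rewrite !mulr_ge0 // ltW.
have h2 : (P ^ u)%:R * (2 * ln X%:R / delta) <= 2 / c0 * C4 * E.
  apply: le_trans h3; rewrite natrX -/y dE.
  have -> : 2 * ln X%:R * (v / c0) = ln X%:R * (2 * (v / c0)) by ring.
  have h0 : 0 <= ln X%:R * (2 * (v / c0)) by rewrite !mulr_ge0 //; lra.
  by apply: ler_wpM2l; [lra|rewrite ler_peMl].
have h4 : J%:R * B <= 2 * C' * C4 * E.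
  apply: (@le_trans _ _ (2 * Lg * B)); first by rewrite ler_wpM2r.
  have -> : 2 * Lg * B = 2 * C' * (Lg ^+ 4 / P%:R ^+ 2) * E.
    by rewrite /B /E exprD; field; rewrite pn gt_eqF.
  apply: ler_wpM2r => //; apply: ler_wpM2l; first by lra.
  rewrite ler_pdivrMr // (le_trans hL) //; apply: ler_wpM2l; first exact: ltW.
  by rewrite expr2 ler_peMl // ltW.
have -> : ((1 + 4 / c0) * C4 + 2 * C' * C4) * (X%:R / P%:R ^+ w) =
   C4 * E + 2 / c0 * C4 * E + 2 / c0 * C4 * E + 2 * C' * C4 * E by rewrite /E; ring.
by rewrite !lerD.
Qed.

(** The summation may stop early while the bound stays in terms of [X]. Sums shorter than [P ^ A0]
    are bounded trivially: [A] exceeds [A0] by [w] for the saving and by 1 for the logarithm. *)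
Theorem exp_sum_bound (t s w : nat) : exists2 A : nat, (w < A)%N &
  forall (c0 C1 : R), 0 < c0 -> exists2 C : R, 0 <= C & forall (P X M : nat) z,
    (0 < P)%N -> (P ^ A <= X)%N -> X%:R <= C1 * P%:R ^+ A -> (M <= X)%N -> normc z = 1 ->
    (forall n, (0 < n)%N -> c0 / (n%:R ^+ t * P%:R ^+ s) <= normc (1 - z ^+ n)) ->
    normc (\sum_(1 <= n < M.+1) (Lam R n)%:C * z ^+ n) <= C * (X%:R / P%:R ^+ w).
Proof.
have [A0 hA0] := exp_sum_long t s w.
exists (A0 + w + 1)%N => [|c0 C1 c0P]; first by lia.
pose C4 := 256 * (1 + `|ln C1| + (A0 + w + 1)%:R) ^+ 4.
have [C C0 hC] := hA0 c0 C4 c0P.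
have C40 : 0 <= C4 by rewrite mulr_ge0 // exprn_ge0 // !addr_ge0.
exists (C + C4); first by rewrite addr_ge0.
move=> P X M z P0 PX XP MX z1 hz.
have p0 : (0 : R) < P%:R by rewrite ltr0n.
have X0 : (0 < X)%N by apply: leq_trans PX; rewrite expn_gt0 P0.
have hL : (1 + ln X%:R) ^+ 4 <= C4 * P%:R by apply: log_fourth_bound XP.
have XPw0 : 0 <= X%:R / P%:R ^+ w :> R by rewrite divr_ge0 // exprn_ge0.
have lnX0 : 0 <= ln (X%:R : R) := ln_nat_ge0 R X.
have lnMX : ln (M%:R : R) <= ln X%:R by rewrite ler_ln_nat.
have lnM0 : 0 <= ln (M%:R : R) := ln_nat_ge0 R M.
have [PM|MP] := leqP (P ^ A0) M.
  apply: (@le_trans _ _ (C * (M%:R / P%:R ^+ w))).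
    apply: hC => //; apply: le_trans hL; rewrite lerXn2r ?nnegrE ?addr_ge0 //.
    by rewrite lerD2l.
  apply: (@le_trans _ _ (C * (X%:R / P%:R ^+ w))).
    by rewrite ler_wpM2l // ler_wpM2r ?invr_ge0 ?exprn_ge0 // ler_nat.
  by rewrite ler_wpM2r // lerDl.
apply: (@le_trans _ _ (M%:R * ln X%:R)).
  apply: le_trans (normc_sum _ _ _) _.
  have -> : M%:R * ln X%:R = \sum_(1 <= n < M.+1) ln (X%:R : R).
    by rewrite sumr_const_nat subSS subn0 -[RHS]mulr_natl.
  apply: ler_sum_nat => n /andP[n0 nM].
  rewrite normcM normc_real normcX z1 expr1n mulr1 ger0_norm ?Lam_ge0 //.
  by apply: le_trans (Lam_le_ln _ _) _; rewrite ler_ln_nat // (leq_trans _ MX).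
have lnC4 : ln X%:R <= C4 * P%:R.
  by apply: le_trans hL; nra.
apply: (@le_trans _ _ (P%:R ^+ A0 * (C4 * P%:R))).
  apply: ler_pM => //; rewrite -natrX ler_nat; exact: ltnW.
apply: (@le_trans _ _ (C4 * (X%:R / P%:R ^+ w))); last by rewrite ler_wpM2r // lerDr.
rewrite mulrCA ler_wpM2l // ler_pdivlMr ?exprn_gt0 // -exprSr -exprD -natrX ler_nat.
by apply: leq_trans PX; rewrite leq_pexp2l //; lia.
Qed.

End VonMangoldtExpSum.

(** * Diophantine bounds from finite type *)

Section FiniteType.
Variable R : realType.
Implicit Types alpha x : R.

Lemma dist_int_le x (k : int) : dist_int x <= `|x - k%:~R|.
Proof.
rewrite /dist_int; apply: ge_inf; last by exists k.
by exists 0 => _ [j _ <-].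
Qed.

Lemma dist_int_ge0 x : 0 <= dist_int x.
Proof.
rewrite /dist_int; apply: lb_le_inf; first by exists `|x - 0%:~R|, 0.
by move=> _ [j _ <-].
Qed.

Lemma nonint_dist x : (forall k : int, x <> k%:~R) ->
  exists2 d : R, 0 < d & forall k : int, d <= `|x - k%:~R|.
Proof.
move=> xk; pose f := Num.floor x.
have f1 : f%:~R <= x := floor_le x.
have f2 : x < f%:~R + 1 by have := floorD1_gt x; rewrite intrD.
have f3 : f%:~R < x by rewrite lt_neqAle f1 andbT; apply/eqP => e; exact: (xk f).
exists (Num.min (x - f%:~R) (f%:~R + 1 - x)); first by rewrite lt_min !subr_gt0 f3.
move=> k; rewrite ge_min.
have [kf|fk] := leP k f.
  have : k%:~R <= f%:~R :> R by rewrite ler_int.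
  by move=> h; rewrite ger0_norm ?subr_ge0 ?lerD2l ?lerN2 ?h // (le_trans h).
have h : f%:~R + 1 <= k%:~R :> R by rewrite -(intrD _ f 1) ler_int lezD1.
by apply/orP; right; rewrite distrC ger0_norm ?lerD2r // subr_ge0 (le_trans (ltW f2)).
Qed.

Lemma irrational_mul_nonint alpha n (k : int) : irrational alpha -> (0 < n)%N ->
  alpha * n%:R <> k%:~R.
Proof.
move=> irr n0 e; apply: irr; exists (k%:~R / n%:R) => //.
rewrite fmorph_div /= ratr_int ratr_nat -e mulfK //.
by rewrite pnatr_eq0 -lt0n.
Qed.

(** A natural number t above the supremum lies outside the set, so the limit inferior at exponent t
    is not 0. It is the supremum of the infima of the tails, all nonnegative, hence one of these is
    positive. *)
Lemma finite_type_tail alpha : finite_type alpha ->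
  exists t m : nat, exists2 c : R, 0 < c & forall n, (m <= n)%N ->
    c <= n%:R ^+ t * dist_int (alpha * n%:R).
Proof.
rewrite /finite_type /diophantine_type => ft.
set S := [set _ | _ in _]%classic in ft.
have [t ht] : exists t : nat, (ereal_sup S < t%:R%:E)%E.
  move: ft; case: (ereal_sup S) => [r _| //|_]; last by exists 0%N; rewrite ltNyr.
  by exists (Num.truncn `|r|).+1; rewrite lte_fin (le_lt_trans (ler_norm r)) // truncnS_gt.
pose u n := (n%:R ^+ t * dist_int (alpha * n%:R))%:E.
have uE : u = (fun n : nat => (n%:R `^ t%:R * dist_int (alpha * n%:R))%:E).
  by apply/funext => n; rewrite /u powR_mulrn.
have u0 n : (0 <= u n)%E by rewrite lee_fin mulr_ge0 ?exprn_ge0 ?dist_int_ge0.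
have hu : limn_einf u <> 0%E.
  move=> h; move: ht; rewrite ltNge; apply/negP/negPn.
  apply: ereal_sup_ubound; exists t%:R => //=.
  by rewrite -h uE.
have limE : limn_einf u = ereal_sup (range (einfs u)).
  by rewrite limn_einf_lim; apply/cvg_lim => //; exact: cvg_einfs_sup.
have einfs0 m : (0 <= einfs u m)%E.
  by apply: le_ereal_inf_tmp => _ [k _ <-].
have [m hm] : exists m, (0 < einfs u m)%E.
  apply: contrapT => /forallNP h; apply: hu; rewrite limE.
  apply/eqP; rewrite eq_le; apply/andP; split.
    by apply: ge_ereal_sup => _ [m _ <-]; rewrite leNgt; apply/negP.
  by apply: (le_trans (einfs0 0%N)); apply: ereal_sup_ubound; exists 0%N.
have [c c0 hc] : exists2 c : R, 0 < c & (c%:E <= einfs u m)%E.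
  move: hm; case: (einfs u m) => [r|_|//]; first by exists r.
  by exists 1 => //; rewrite leey.
exists t, m, c => // n mn; rewrite -lee_fin; apply: le_trans hc _.
by apply: ereal_inf_lbound; exists n.
Qed.

(** The finitely many n below the tail are covered by irrationality, at the cost of a smaller
    constant. *)
Lemma finite_type_bound alpha : irrational alpha -> finite_type alpha ->
  exists t : nat, exists2 c : R, 0 < c &
    forall (n : nat) (k : int), (0 < n)%N -> c / n%:R ^+ t <= `|alpha * n%:R - k%:~R|.
Proof.
move=> irr /finite_type_tail [t [m [c c0 hc]]].
have [d d0 hd] : exists2 d : R, 0 < d &
    forall (n : nat) (k : int), (0 < n < m)%N -> d <= `|alpha * n%:R - k%:~R|.
  elim: (m) => [|j [d d0 hd]]; first by exists 1 => // n k; rewrite ltn0 andbF.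
  have [->|j0] := posnP j; first by exists 1 => // n k; lia.
  have [e e0 he] := nonint_dist (fun k => irrational_mul_nonint (k := k) irr j0).
  exists (Num.min d e); first by rewrite lt_min d0.
  move=> n k /andP[n0]; rewrite ltnS leq_eqVlt => /orP[/eqP ->|nj].
    by rewrite ge_min he orbT.
  by rewrite ge_min hd ?n0.
exists t, (Num.min c d); first by rewrite lt_min c0.
move=> n k n0.
have n1 : (1 : R) <= n%:R ^+ t by rewrite exprn_ege1 // ler1n.
have np : (0 : R) < n%:R ^+ t by apply: lt_le_trans n1.
rewrite ler_pdivrMr // ge_min; apply/orP.
have [nm|mn] := ltnP n m; [right|left].
  by rewrite (le_trans (hd n k _)) ?n0 // ler_peMr.
by apply: le_trans (hc n mn) _; rewrite mulrC ler_wpM2r ?dist_int_le // ltW.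
Qed.

(** Multiplication by alpha exchanges the roles of n and k: alpha |n / alpha + k| = |alpha k + n|,
    to which the bound for alpha applies with |k| as multiplier. This requires k nonzero, and |k| <=
    [D * n] holds when the distance is below 1; the cases k = 0 and distance at least 1 are
    direct. *)
Lemma finite_type_inv alpha : 0 < alpha -> irrational alpha -> finite_type alpha ->
  exists t : nat, exists2 c : R, 0 < c &
    forall (n : nat) (k : int), (0 < n)%N ->
      c / n%:R ^+ t <= `|- alpha^-1 * n%:R - k%:~R|.
Proof.
move=> a0 irr ft; have [t [c c0 hc]] := finite_type_bound irr ft.
have ai : 0 < alpha^-1 by rewrite invr_gt0.
pose D := alpha^-1 + 1.
have D0 : 0 < D by rewrite addr_gt0.
pose e := c / (alpha * D ^+ t).
have e0 : 0 < e by rewrite divr_gt0 // mulr_gt0 // exprn_gt0.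
exists t, (Num.min 1 (Num.min alpha^-1 e)); first by rewrite !lt_min ltr01 ai e0.
move=> n k n0.
have n1 : (1 : R) <= n%:R by rewrite ler1n.
have nt1 : (1 : R) <= n%:R ^+ t by rewrite exprn_ege1.
have np : (0 : R) < n%:R ^+ t by apply: lt_le_trans nt1.
rewrite ler_pdivrMr // !ge_min.
have [h1|h1] := leP 1 `|- alpha^-1 * n%:R - k%:~R|.
  by rewrite mulr_ege1.
apply/orP; right; apply/orP.
have [k0|kn0] := eqVneq k 0.
  left; rewrite k0 subr0 mulNr normrN ger0_norm ?mulr_ge0 ?(ltW ai) //.
  by rewrite -mulrA ler_peMr ?(ltW ai) // mulr_ege1.
right.
have kp : (0 < `|k|)%N by rewrite absz_gt0.
have key : c / `|k|%N%:R ^+ t <= alpha * `|- alpha^-1 * n%:R - k%:~R|.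
  rewrite -[X in _ <= X * _]gtr0_norm // -normrM.
  have -> : alpha * (- alpha^-1 * n%:R - k%:~R) = - (alpha * k%:~R + n%:R).
    by field; rewrite gt_eqF.
  rewrite normrN.
  case: (intP k) kp {h1 kn0} => [//|j _|j _].
    by have := hc j.+1 (- n%:Z) isT; rewrite absz_nat mulrNz opprK.
  have := hc j.+1 n%:Z isT; rewrite abszN absz_nat mulrNz mulrN.
  by rewrite [in X in _ -> X]addrC [in X in _ -> X]distrC.
have kD : `|k|%N%:R <= D * n%:R.
  have -> : `|k|%N%:R = `|k%:~R| :> R by rewrite -intr_norm -abszE.
  have -> : k%:~R = - (- alpha^-1 * n%:R - k%:~R) + (- alpha^-1 * n%:R) :> R by ring.
  apply: le_trans (ler_normD _ _) _; rewrite normrN mulNr normrN.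
  rewrite [X in _ + X]ger0_norm ?mulr_ge0 ?(ltW ai) // mulrDl mul1r addrC lerD2l.
  by rewrite -mulNr (le_trans (ltW h1)).
have kt0 : (0 : R) < `|k|%N%:R ^+ t by rewrite exprn_gt0 // ltr0n.
have kt : `|k|%N%:R ^+ t <= D ^+ t * n%:R ^+ t.
  by rewrite -exprMn lerXn2r ?nnegrE ?mulr_ge0 ?(ltW D0).
rewrite /e ler_pdivrMr ?mulr_gt0 ?exprn_gt0 //.
move: key; rewrite ler_pdivrMr // => key.
set N := `|_ * n%:R - _| in key *.
have N0 : 0 <= N := normr_ge0 _.
apply: le_trans key _.
have -> : N * n%:R ^+ t * (alpha * D ^+ t) = alpha * N * (D ^+ t * n%:R ^+ t) by ring.
by rewrite ler_wpM2l // mulr_ge0 // ltW.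
Qed.

Lemma finite_type_chord alpha : 0 < alpha -> irrational alpha -> finite_type alpha ->
  exists t : nat, exists2 c : R, 0 < c & forall n : nat, (0 < n)%N ->
    c / n%:R ^+ t <= normc (1 - expi (- alpha^-1) ^+ n).
Proof.
move=> a0 irr ft; have [t [c c0 hc]] := finite_type_inv a0 irr ft.
exists t, c => // n n0; rewrite -expi_mulrn; apply: chord_ge_dist => k.
exact: hc.
Qed.

End FiniteType.

(** * Fejer kernels on a finite grid *)

Section FejerSmoothing.
Variable R : realType.

Definition fejer (H : nat) (x : R) : R :=
  normc (\sum_(l < H) expi x ^+ l) ^+ 2 / H%:R.

Lemma fejer_ge0 H x : 0 <= fejer H x.
Proof. by rewrite divr_ge0 // sqr_ge0. Qed.

Lemma fejer_chord H x : (0 < H)%N -> fejer H x * normc (1 - expi x) ^+ 2 <= 4 / H%:R.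
Proof.
move=> H0; rewrite /fejer mulrAC ler_wpM2r ?invr_ge0 // -exprMn mulrC.
have := geometric_sum_bound 0 H (normc_expi x); rewrite big_mkord => hv.
have -> : (4 : R) = 2 ^+ 2 by rewrite -natrX.
by rewrite lerXn2r ?nnegrE // mulr_ge0 ?normc_ge0.
Qed.

(** In the expanded square the H diagonal terms give exactly the total weight after division by H;
    each of the other terms is at most E. *)
Lemma fejer_mean (I : Type) (r : seq I) (w x : I -> R) (H : nat) (E : R) :
  (0 < H)%N -> 0 <= E ->
  (forall k, (0 < k < H)%N -> normc (\sum_(i <- r) (w i)%:C * expi (x i) ^+ k) <= E) ->
  `|\sum_(i <- r) w i * fejer H (x i) - \sum_(i <- r) w i| <= H%:R * E.
Proof.
move=> H0 E0 hE; have Hp : (0 : R) < H%:R by rewrite ltr0n.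
pose g (l k : nat) : R[i] := \sum_(i <- r) (w i)%:C * (expi (x i) ^+ l * (expi (x i))^* ^+ k).
have W_real : (\sum_(i <- r) w i)%:C = \sum_(i <- r) (w i)%:C by rewrite rmorph_sum.
have gd l : g l l = (\sum_(i <- r) w i)%:C.
  rewrite W_real; apply: eq_bigr => i _.
  by rewrite -exprMn unit_mul_conj ?normc_expi // expr1n mulr1.
have g_gt (l k : nat) : (k < l < H)%N -> normc (g l k) <= E.
  move=> /andP[kl lH]; have := hE (l - k)%N; rewrite subn_gt0 kl.
  rewrite (leq_ltn_trans (leq_subr _ _) lH) => /(_ isT).
  congr (normc _ <= _); apply: eq_bigr => i _; congr (_ * _).
  rewrite -{2}(subnK (ltnW kl)) exprD -mulrA -exprMn unit_mul_conj ?normc_expi //.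
  by rewrite expr1n mulr1.
have g_conj (l k : nat) : g l k = (g k l)^*.
  rewrite rmorph_sum; apply: eq_bigr => i _; move: (expi _) => v.
  rewrite !rmorphM /= !rmorphXn /= conjcK (_ : w i -i* 0 = (w i)%:C) ?oppr0 //.
  by rewrite [_ ^+ l * _]mulrC.
have g_off (l k : 'I_H) : normc (g l k - (if k == l then (\sum_(i <- r) w i)%:C else 0)) <= E.
  case: eqVneq => [->|lk]; first by rewrite gd subrr normc0.
  rewrite subr0; case: (ltngtP l k) => h; last by rewrite (val_inj h) eqxx in lk.
    by rewrite g_conj normc_conj g_gt // h ltn_ord.
  by rewrite g_gt // h ltn_ord.
have key : ((\sum_(i <- r) w i * fejer H (x i) - \sum_(i <- r) w i) * H%:R)%:C =
    \sum_(l < H) \sum_(k < H) (g l k - (if k == l then (\sum_(i <- r) w i)%:C else 0)).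
  under [RHS]eq_bigr => l _ do rewrite sumrB -big_mkcond /= big_pred1_eq.
  rewrite sumrB /= sumr_const card_ord mulrBl rmorphB /=; congr (_ - _); last first.
    by rewrite mulr_natr rmorphMn.
  rewrite big_distrl rmorph_sum /=.
  under [RHS]eq_bigr => l _ do rewrite exchange_big /=.
  rewrite [RHS]exchange_big /=; apply: eq_bigr => i _.
  rewrite /fejer mulrA divfK ?gt_eqF // rmorphM /= -normc_mul_conj.
  rewrite rmorph_sum big_distrl /= big_distrr /=; apply: eq_bigr => l _.
  by rewrite !big_distrr /=; apply: eq_bigr => k _; rewrite rmorphXn.
rewrite -(@ler_pM2r _ H%:R) // -{1}[H%:R]gtr0_norm // -normrM -normc_real key.
apply: le_trans (normc_sum _ _ _) _.
have -> : H%:R * E * H%:R = \sum_(l < H) H%:R * E by rewrite sumr_const card_ord mulr_natr.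
apply: ler_sum => l _; apply: le_trans (normc_sum _ _ _) _.
have -> : H%:R * E = \sum_(k < H) E by rewrite sumr_const card_ord mulr_natl.
by apply: ler_sum.
Qed.

Lemma expi_inv_pow (H : nat) : (0 < H)%N -> expi (H%:R^-1 : R) ^+ H = 1.
Proof. by move=> H0; rewrite -expi_mulrn mulVf ?expi1 // pnatr_eq0 -lt0n. Qed.

Lemma expi_ratio_eq1 (q a b : nat) : (0 < q)%N ->
  (expi ((a%:R - b%:R) / q%:R : R) == 1) = (a == b %[mod q]).
Proof.
move=> q0; have qn : q%:R != 0 :> R by rewrite pnatr_eq0 -lt0n.
have zmod (x y : nat) (k : int) : x%:Z - y%:Z = k * q%:Z -> x = y %[mod q].
  move=> e; have : (x%:Z = y%:Z %[mod q%:Z])%Z.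
    by apply/eqP; rewrite eqz_mod_dvd; apply/dvdzP; exists k.
  by rewrite !modz_nat => [[]].
apply/eqP/eqP => [/expi_eq1[k e]|/eqP e].
  apply: (@zmod _ _ k); apply: (@intr_inj R).
  by rewrite intrD mulrNz intrM -e divfK.
have : (a%:Z == b%:Z %[mod q%:Z])%Z by rewrite !modz_nat eqz_nat.
rewrite eqz_mod_dvd => /dvdzP[k ek].
have -> : (a%:R - b%:R) / q%:R = k%:~R :> R.
  have -> : a%:R - b%:R = k%:~R * q%:R :> R.
    by have := congr1 (intr : int -> R) ek; rewrite intrD mulrNz intrM.
  by rewrite mulfK.
exact: expi_int.
Qed.

Lemma node_orthogonality (H k : nat) (x : R) : (0 < k < H)%N ->
  \sum_(j < H) (1 : R)%:C * expi (x - j%:R / H%:R) ^+ k = 0.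
Proof.
move=> /andP[k0 kH]; have H0 : (0 < H)%N by apply: leq_trans kH.
pose v : R[i] := expi ((0%:R - k%:R) / H%:R).
have -> : \sum_(j < H) (1 : R)%:C * expi (x - j%:R / H%:R) ^+ k =
    expi x ^+ k * \sum_(j < H) v ^+ j.
  rewrite big_distrr /=; apply: eq_bigr => j _.
  rewrite mul1r expiD exprMn; congr (_ * _); rewrite -!expi_mulrn; congr expi.
  by rewrite /v sub0r; ring.
rewrite root_unity_sum ?mulr0 //.
  rewrite -expi_mulrn divfK ?pnatr_eq0 -?lt0n // sub0r expiN.
  by rewrite -[k%:R]mul1r expi_mulrn expi1 expr1n conjc1.
by rewrite expi_ratio_eq1 // mod0n modn_small // eq_sym -lt0n.
Qed.

(** This is [fejer_mean] with error 0, since the frequencies 0 < k < H cancel on H equidistant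
    nodes. The exact value lets the grid take the place of an integral. *)
Lemma fejer_nodes (H : nat) (x : R) : (0 < H)%N ->
  \sum_(j < H) fejer H (x - j%:R / H%:R) = H%:R.
Proof.
move=> H0.
have := @fejer_mean _ (index_enum 'I_H) (fun=> 1) (fun j : 'I_H => x - j%:R / H%:R)
  H 0 H0 (lexx 0).
have h k : (0 < k < H)%N ->
    normc (\sum_(j < H) (1 : R)%:C * expi (x - j%:R / H%:R) ^+ k) <= 0.
  by move=> hk; rewrite node_orthogonality // normc0.
move=> /(_ h); rewrite mulr0 normr_le0 subr_eq0 => /eqP.
rewrite sumr_const card_ord => hs; rewrite -[RHS]hs.
by apply: eq_bigr => j _; rewrite mul1r.
Qed.

Section Smoothing.
Variables (h : R -> R) (D : R).
Hypothesis D_ge0 : 0 <= D.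
Hypothesis h_lip : forall x y, `|h x - h y| <= D * normc (1 - expi (x - y)).
Hypothesis h_le1 : forall x, `|h x| <= 1.

(** The grid version of the integral of [h] over a period. *)
Definition node_mean (H : nat) : R := (\sum_(j < H) h (j%:R / H%:R)) / H%:R.

Lemma fejer_approx (H : nat) (e x : R) : (0 < H)%N -> 0 < e ->
  `|h x - (\sum_(j < H) h (j%:R / H%:R) * fejer H (x - j%:R / H%:R)) / H%:R|
  <= D * (e + 4 / (H%:R * e)).
Proof.
move=> H0 e0; have Hp : (0 : R) < H%:R by rewrite ltr0n.
rewrite -(@ler_pM2r _ H%:R) // -[X in _ * X <= _]gtr0_norm // -normrM mulrBl divfK ?gt_eqF //.
rewrite -{1}(fejer_nodes x H0) big_distrr /= -sumrB.
apply: le_trans (ler_norm_sum _ _ _) _.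
apply: (@le_trans _ _ (\sum_(j < H) (D * e * fejer H (x - j%:R / H%:R) + D * (4 / H%:R / e)))).
  apply: ler_sum => j _; set y := x - _; rewrite -mulrBl normrM (ger0_norm (fejer_ge0 _ _)).
  apply: (@le_trans _ _ (D * normc (1 - expi y) * fejer H y)).
    by rewrite ler_wpM2r ?fejer_ge0 ?h_lip.
  have c1 := @fejer_chord H y H0; have f0 := fejer_ge0 H y; have n0 := normc_ge0 (1 - expi y).
  set n := normc _ in c1 n0 *; set f := fejer H y in c1 f0 *.
  (* This replaces a division of the nodes into near and far ones: the quadratic term is controlled
     by [fejer_chord]. *)
  have ne : n <= e + n ^+ 2 / e.
    have [ne|en] := leP n e; first by rewrite (le_trans ne) // lerDl divr_ge0 ?sqr_ge0 ?ltW.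
    rewrite -[X in X <= _]add0r lerD ?(ltW e0) // ler_pdivlMr // expr2.
    by rewrite ler_wpM2l // ltW.
  have nf : n * f <= e * f + 4 / H%:R / e.
    apply: (@le_trans _ _ ((e + n ^+ 2 / e) * f)); first by rewrite ler_wpM2r.
    have -> : (e + n ^+ 2 / e) * f = e * f + (f * n ^+ 2) / e by ring.
    by rewrite lerD2l ler_wpM2r // invr_ge0 ltW.
  have -> : D * n * f = D * (n * f) by ring.
  have -> : D * e * f + D * (4 / H%:R / e) = D * (e * f + 4 / H%:R / e) by ring.
  by rewrite ler_wpM2l.
rewrite big_split /= -big_distrr /= fejer_nodes // sumr_const card_ord -mulr_natr.
rewrite le_eqVlt; apply/orP; left; apply/eqP.
by field; rewrite !gt_eqF.
Qed.

(** [h] is replaced by a combination of translates of the Fejer kernel. A translation multiplies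
    each exponential sum by a number of modulus 1, so [fejer_mean] applies at every node. *)
Lemma smooth_equidistribution (I : Type) (r : seq I) (w x : I -> R) (H : nat) (e E : R) :
  (0 < H)%N -> 0 < e -> 0 <= E -> (forall i, 0 <= w i) ->
  (forall k, (0 < k < H)%N -> normc (\sum_(i <- r) (w i)%:C * expi (x i) ^+ k) <= E) ->
  `|\sum_(i <- r) w i * h (x i) - (\sum_(i <- r) w i) * node_mean H| <=
  (\sum_(i <- r) w i) * (D * (e + 4 / (H%:R * e))) + H%:R * E.
Proof.
move=> H0 e0 E0 w0 hE; have Hp : (0 : R) < H%:R by rewrite ltr0n.
pose T y : R := (\sum_(j < H) h (j%:R / H%:R) * fejer H (y - j%:R / H%:R)) / H%:R.
have -> : \sum_(i <- r) w i * h (x i) - (\sum_(i <- r) w i) * node_mean H =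
  (\sum_(i <- r) w i * (h (x i) - T (x i))) +
  (\sum_(i <- r) w i * T (x i) - (\sum_(i <- r) w i) * node_mean H).
  rewrite addrA -big_split /=; congr (_ - _); apply: eq_bigr => i _.
  by rewrite -mulrDr subrK.
apply: le_trans (ler_normD _ _) _; apply: lerD.
  apply: le_trans (ler_norm_sum _ _ _) _; rewrite big_distrl /=; apply: ler_sum => i _.
  by rewrite normrM ger0_norm // ler_wpM2l // fejer_approx.
have -> : \sum_(i <- r) w i * T (x i) - (\sum_(i <- r) w i) * node_mean H =
  (\sum_(j < H) h (j%:R / H%:R) * (\sum_(i <- r) w i * fejer H (x i - j%:R / H%:R)
     - \sum_(i <- r) w i)) / H%:R.
  rewrite /node_mean mulrA -[X in X - _](_ : (\sum_(i <- r) w i * (T (x i) * H%:R)) / H%:R = _);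
    last by rewrite big_distrl /=; apply: eq_bigr => i _; rewrite -mulrA mulfK ?gt_eqF.
  rewrite -mulrBl; congr (_ / _).
  under [RHS]eq_bigr => j _ do rewrite mulrBr.
  rewrite sumrB -big_distrl /= [X in _ = _ - X]mulrC; congr (_ - _).
  under eq_bigr => i _ do rewrite /T divfK ?gt_eqF // big_distrr /=.
  rewrite exchange_big /=; apply: eq_bigr => j _.
  by rewrite big_distrr /=; apply: eq_bigr => i _; rewrite mulrCA.
rewrite normrM normfV (gtr0_norm Hp) ler_pdivrMr //.
apply: le_trans (ler_norm_sum _ _ _) _.
have -> : H%:R * E * H%:R = \sum_(j < H) H%:R * E by rewrite sumr_const card_ord mulr_natr.
apply: ler_sum => j _; rewrite normrM -[leRHS]mul1r; apply: ler_pM => //.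
apply: fejer_mean => // k hk; apply: le_trans (hE k hk).
have -> : \sum_(i <- r) (w i)%:C * expi (x i - j%:R / H%:R) ^+ k =
   expi (- (j%:R / H%:R)) ^+ k * \sum_(i <- r) (w i)%:C * expi (x i) ^+ k.
  by rewrite big_distrr /=; apply: eq_bigr => i _; rewrite expiD exprMn; ring.
by rewrite normcM normcX normc_expi expr1n mul1r.
Qed.

End Smoothing.
End FejerSmoothing.

(** * Detection of residue classes by additive characters *)

Section ResidueClasses.
Variable R : realType.

(** The indicator of the class is the average over b < q of the characters e(b (m - a) / q); being
    an average, it loses no factor q. *)
Lemma residue_exp_sum (f : nat -> R) (z : R[i]) (q a M : nat) (E : R) : (0 < q)%N ->
  (forall b, normc (\sum_(1 <= m < M.+1) (f m)%:C * (expi (q%:R^-1) ^+ b * z) ^+ m) <= E) ->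
  normc (\sum_(1 <= m < M.+1 | m == a %[mod q]) (f m)%:C * z ^+ m) <= E.
Proof.
move=> q0 hE; have qp : (0 : R) < q%:R by rewrite ltr0n.
pose om : R[i] := expi q%:R^-1.
have ind m : \sum_(b < q) om ^+ (b * m) * (om ^+ (b * a))^* =
    (if m == a %[mod q] then q%:R else 0)%:C.
  pose v : R[i] := expi ((m%:R - a%:R) / q%:R).
  have -> : \sum_(b < q) om ^+ (b * m) * (om ^+ (b * a))^* = \sum_(b < q) v ^+ b.
    apply: eq_bigr => b _; rewrite /v /om -!expi_mulrn.
    rewrite [X in _ * X](_ : _ = expi (- (q%:R^-1 * (b * a)%:R))); last by rewrite expiN.
    rewrite -expiD; congr expi.
    by rewrite !natrM; ring.
  have [e|ne] := boolP (m == a %[mod q]).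
    have -> : v = 1 by apply/eqP; rewrite expi_ratio_eq1.
    under eq_bigr => b _ do rewrite expr1n.
    by rewrite sumr_const card_ord rmorph_nat.
  rewrite root_unity_sum // ?expi_ratio_eq1 //.
  rewrite -expi_mulrn divfK ?gt_eqF // expiD expiN.
  by rewrite -[m%:R]mul1r -[a%:R]mul1r !expi_mulrn expi1 !expr1n conjc1 mulr1.
have key : q%:R%:C * \sum_(1 <= m < M.+1 | m == a %[mod q]) (f m)%:C * z ^+ m =
   \sum_(b < q) (om ^+ (b * a))^* * \sum_(1 <= m < M.+1) (f m)%:C * (om ^+ b * z) ^+ m.
  under [RHS]eq_bigr => b _ do rewrite big_distrr /=.
  rewrite exchange_big /= big_mkcond big_distrr /=; apply: eq_bigr => m _.
  transitivity ((\sum_(b < q) om ^+ (b * m) * (om ^+ (b * a))^*) * ((f m)%:C * z ^+ m)).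
    by rewrite ind; case: ifP; rewrite ?mul0r ?mulr0.
  by rewrite big_distrl /=; apply: eq_bigr => b _; rewrite exprMn exprM; ring.
rewrite -(@ler_pM2l _ q%:R) // -{1}[q%:R]gtr0_norm // -normc_real -normcM key.
apply: le_trans (normc_sum _ _ _) _.
have -> : q%:R * E = \sum_(b < q) E by rewrite sumr_const card_ord mulr_natl.
apply: ler_sum => b _; rewrite normcM normc_conj normcX normc_expi expr1n mul1r.
exact: hE.
Qed.

End ResidueClasses.

(** * Continuous majorant and minorant of the sawtooth *)

Section Sawtooth.
Variable R : realType.

Definition frac (x : R) : R := x - (Num.floor x)%:~R.

Lemma frac_itv x : 0 <= frac x < 1.
Proof.
rewrite /frac subr_ge0 floor_le /= ltrBlDl.
by have := floorD1_gt x; rewrite intrD.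
Qed.

Lemma expi_frac x : expi (frac x) = expi x.
Proof. by rewrite /frac expiD expiN expi_int conjc1 mulr1. Qed.

(** Since [phi 0 = phi 1], the increment can be taken along the shorter arc, directly or through the
    integer point, and [chord_ge] compares this arc with the chord. *)
Lemma lipschitz_frac (phi : R -> R) (D : R) : 0 <= D -> phi 0 = phi 1 ->
  (forall s t, 0 <= s -> s <= t -> t <= 1 -> `|phi t - phi s| <= D * (t - s)) ->
  forall x y, `|phi (frac x) - phi (frac y)| <= D * normc (1 - expi (x - y)).
Proof.
move=> D0 h01 hphi.
have sym x y : normc (1 - expi (x - y)) = normc (1 - expi (y - x)).
  rewrite -[x - y]opprB expiN; case: (expi (y - x)) => a b.
  by rewrite !normcE /=; congr Num.sqrt; ring.
have main x y : frac y <= frac x ->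
    `|phi (frac x) - phi (frac y)| <= D * normc (1 - expi (x - y)).
  have -> : expi (x - y) = expi (frac x - frac y).
    by rewrite (expiD x) (expiD (frac x)) !expiN !expi_frac.
  move: (frac_itv x) (frac_itv y); move: (frac x) (frac y) => u v.
  move=> /andP[u0 u1] /andP[v0 v1] vu.
  apply: (@le_trans _ _ (D * Num.min (u - v) (1 - (u - v)))); last first.
    rewrite ler_wpM2l // chord_ge //; apply/andP; split; lra.
  have [_|_] := leP (u - v) (1 - (u - v)); first by rewrite hphi // ltW.
  have -> : phi u - phi v = - (phi 1 - phi u) + - (phi v - phi 0) by rewrite h01; ring.
  apply: le_trans (ler_normD _ _) _; rewrite !normrN.
  have -> : D * (1 - (u - v)) = D * (1 - u) + D * (v - 0) by ring.
  by apply: lerD; apply: hphi; rewrite // ltW.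
move=> x y; have [h|h] := leP (frac y) (frac x); first exact: main.
by rewrite distrC sym main // ltW.
Qed.

(* Composed with [frac], these are continuous and agree with it away from its jump. *)
Definition saw_upper (d s : R) : R := Num.max s (1 - d * s).
Definition saw_lower (d s : R) : R := Num.min s (d * (1 - s)).

Variable d : R.
Hypothesis d_ge1 : 1 <= d.

Lemma saw_upper_lip s t : 0 <= s -> s <= t -> t <= 1 ->
  `|saw_upper d t - saw_upper d s| <= d * (t - s).
Proof.
move=> s0 st t1; rewrite ler_norml /saw_upper.
have h : t - s <= d * (t - s) by rewrite ler_peMl // subr_ge0.
rewrite mulrBr in h *.
by case: (leP t (1 - d * t)) => ?; case: (leP s (1 - d * s)) => ?;
   apply/andP; split; lra.
Qed.

Lemma saw_lower_lip s t : 0 <= s -> s <= t -> t <= 1 ->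
  `|saw_lower d t - saw_lower d s| <= d * (t - s).
Proof.
move=> s0 st t1; rewrite ler_norml /saw_lower.
have h : t - s <= d * (t - s) by rewrite ler_peMl // subr_ge0.
rewrite !mulrBr mulr1 in h *.
by case: (leP t (d - d * t)) => ?; case: (leP s (d - d * s)) => ?;
   apply/andP; split; lra.
Qed.

Lemma saw_upper_le1 x : `|saw_upper d (frac x)| <= 1.
Proof.
have /andP[f0 f1] := frac_itv x; rewrite ler_norml /saw_upper.
have df : 0 <= d * frac x by rewrite mulr_ge0 // (le_trans ler01).
by case: (leP (frac x) (1 - d * frac x)) => ?; apply/andP; split; lra.
Qed.

Lemma saw_lower_le1 x : `|saw_lower d (frac x)| <= 1.
Proof.
have /andP[f0 f1] := frac_itv x; rewrite ler_norml /saw_lower.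
have df : 0 <= d * (1 - frac x) by rewrite mulr_ge0 ?subr_ge0 ?ltW // (lt_le_trans ltr01).
by case: (leP (frac x) (d * (1 - frac x))) => ?; apply/andP; split; lra.
Qed.

Lemma saw_bounds x : saw_lower d (frac x) <= frac x <= saw_upper d (frac x).
Proof. by rewrite /saw_lower /saw_upper ge_min le_max !lexx. Qed.

End Sawtooth.

(** * Discrepancy of weighted fractional parts *)

Section SawtoothSums.
Variable R : realType.

Lemma count_low (H e : nat) : (\sum_(0 <= j < H) (j <= e) = minn H e.+1)%N.
Proof. by elim: H => [|H IH]; [rewrite big_geq|rewrite big_nat_recr //= IH; lia]. Qed.

Lemma count_high (H e T : nat) : (\sum_(0 <= j < H) (T <= j + e) = H - (T - e))%N.
Proof. by elim: H => [|H IH]; [rewrite big_geq|rewrite big_nat_recr //= IH; lia]. Qed.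

(** Majorant and minorant agree with x when d x > 1 and d (1 - x) > 1. At most e + 1 nodes on the
    left and e on the right fail this; each contributes at most 1, and 2 e + 1 <= 3 e. *)
Lemma node_mean_gap (d e : nat) : (0 < d)%N -> (0 < e)%N ->
  node_mean (fun x : R => saw_upper d%:R (frac x)) (d * e)
  - node_mean (fun x : R => saw_lower d%:R (frac x)) (d * e) <= 3 / d%:R.
Proof.
move=> d0 e0; rewrite /node_mean -mulrBl -sumrB /=.
have dp : (0 : R) < d%:R by rewrite ltr0n.
have ep : (0 : R) < e%:R by rewrite ltr0n.
have d1 : (1 : R) <= d%:R by rewrite ler1n.
have H0 : (0 : R) < (d * e)%:R by rewrite ltr0n muln_gt0 d0.
rewrite ler_pdivrMr //.
have -> : 3 / d%:R * (d * e)%:R = 3 * e%:R :> R by rewrite natrM; field; rewrite gt_eqF.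
have pt (j : 'I_(d * e)) : saw_upper d%:R (frac (j%:R / (d * e)%:R)) -
    saw_lower d%:R (frac (j%:R / (d * e)%:R)) <= (((j <= e) + (d * e <= j + e))%N)%:R :> R.
  set x := j%:R / _.
  have [/orP je|] := boolP ((j <= e)%N || (d * e <= j + e)%N).
    apply: (@le_trans _ _ 1); last by rewrite ler1n addn_gt0 !lt0b; apply/orP.
    have /andP[f0 f1] := frac_itv x; rewrite /saw_upper /saw_lower.
    have df : 0 <= d%:R * frac x by rewrite mulr_ge0 // ltW.
    have dg : 0 <= d%:R * (1 - frac x) by rewrite mulr_ge0 // ?subr_ge0 ltW.
    by case: (leP (frac x) (1 - _)) => ?; case: (leP (frac x) (d%:R * _)) => ?; lra.
  rewrite negb_or -!ltnNge => /andP[ej jH].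
  have x01 : 0 <= x < 1 by rewrite divr_ge0 //= ltr_pdivrMr // mul1r ltr_nat.
  have -> : frac x = x.
    rewrite /frac (_ : Num.floor x = 0) ?subr0 //; apply/eqP.
    by rewrite floor_eq add0r.
  have xH : x * (d%:R * e%:R) = j%:R by rewrite -natrM /x divfK ?gt_eqF.
  have h1 : 1 < d%:R * x.
    have : e%:R < j%:R :> R by rewrite ltr_nat.
    by rewrite -xH; nra.
  have h2 : 1 < d%:R * (1 - x).
    have : j%:R + e%:R < d%:R * e%:R :> R by rewrite -natrD -natrM ltr_nat.
    by rewrite -xH; nra.
  move/andP: x01 => [x0 x1]; rewrite /saw_upper /saw_lower.
  have hz : (0 : R) <= (((j <= e) + (d * e <= j + e))%N)%:R by [].
  by case: (leP x (1 - _)) => ?; case: (leP x (d%:R * _)) => ?; lra.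
apply: le_trans (ler_sum _ (fun j _ => pt j)) _.
rewrite -natr_sum big_split /=.
rewrite -(big_mkord xpredT (fun j => nat_of_bool (j <= e)%N)).
rewrite -(big_mkord xpredT (fun j => nat_of_bool (d * e <= j + e)%N)).
rewrite count_low count_high -natrM ler_nat.
move: (d * e)%N => T; move: e0; lia.
Qed.

(** The majorant is used at [s] and the minorant at [s']. The inequality is one-sided because
    exchanging [s] and [s'] gives the other side. *)
Lemma frac_sum_discrepancy (I : Type) (r : seq I) (w x : I -> R) (s s' : R)
    (d e : nat) (eps E : R) :
  (0 < d)%N -> (0 < e)%N -> 0 < eps -> 0 <= E -> (forall i, 0 <= w i) ->
  (forall k, (0 < k < d * e)%N -> normc (\sum_(i <- r) (w i)%:C * expi (x i) ^+ k) <= E) ->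
  \sum_(i <- r) w i * frac (x i + s) - \sum_(i <- r) w i * frac (x i + s') <=
  (\sum_(i <- r) w i) * (3 / d%:R) +
  2 * ((\sum_(i <- r) w i) * (d%:R * (eps + 4 / ((d * e)%:R * eps))) + (d * e)%:R * E).
Proof.
move=> d0 e0 eps0 E0 w0 hE.
have d1 : (1 : R) <= d%:R by rewrite ler1n.
have d0' : (0 : R) <= d%:R by [].
have H0 : (0 < d * e)%N by rewrite muln_gt0 d0.
have hEs u k : (0 < k < d * e)%N ->
    normc (\sum_(i <- r) (w i)%:C * expi (x i + u) ^+ k) <= E.
  move=> hk; apply: le_trans (hE k hk).
  have -> : \sum_(i <- r) (w i)%:C * expi (x i + u) ^+ k =
     expi u ^+ k * \sum_(i <- r) (w i)%:C * expi (x i) ^+ k.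
    by rewrite big_distrr /=; apply: eq_bigr => i _; rewrite expiD exprMn; ring.
  by rewrite normcM normcX normc_expi expr1n mul1r.
have up_lip := lipschitz_frac (phi := saw_upper d%:R) d0' _ (saw_upper_lip d1).
have lo_lip := lipschitz_frac (phi := saw_lower d%:R) d0' _ (saw_lower_lip d1).
have up01 : saw_upper d%:R 0 = saw_upper d%:R 1 :> R.
  by rewrite /saw_upper mulr0 subr0 mulr1 (max_r ler01) max_l //; lra.
have lo01 : saw_lower d%:R 0 = saw_lower d%:R 1 :> R.
  by rewrite /saw_lower subrr mulr0 subr0 mulr1 (min_l d0') (min_r ler01).
have := smooth_equidistribution d0' (up_lip up01) (saw_upper_le1 d1)
  H0 eps0 E0 w0 (hEs s).
have := smooth_equidistribution d0' (lo_lip lo01) (saw_lower_le1 d1)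
  H0 eps0 E0 w0 (hEs s').
have W0 : 0 <= \sum_(i <- r) w i by apply: sumr_ge0.
have := ler_wpM2l W0 (node_mean_gap d0 e0).
rewrite !ler_norml mulrBr.
set W := \sum_(i <- r) w i; set U := W * node_mean _ _; set L := W * node_mean _ _.
move=> h1 /andP[h2 _] /andP[_ h3].
have hu : \sum_(i <- r) w i * frac (x i + s) <=
    \sum_(i <- r) w i * saw_upper d%:R (frac (x i + s)).
  by apply: ler_sum => i _; rewrite ler_wpM2l //; case/andP: (saw_bounds d%:R (x i + s)).
have hl : \sum_(i <- r) w i * saw_lower d%:R (frac (x i + s')) <=
    \sum_(i <- r) w i * frac (x i + s').
  by apply: ler_sum => i _; rewrite ler_wpM2l //; case/andP: (saw_bounds d%:R (x i + s')).
by move: h1 h2 h3 hu hl; lra.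
Qed.

End SawtoothSums.

(* The first three clauses only serve to carry the induction on [N]. *)
Lemma count_interval (A B : int) (N : nat)
    (c := (\sum_(1 <= n < N.+1) nat_of_bool ((A <= n%:Z) && (n%:Z < B))%R)%N) : A <= B ->
  [/\ N%:Z < A -> c = 0%N, (A <= N%:Z + 1 -> N%:Z + 1 <= B -> c%:Z <= N%:Z + 1 - A),
    (B <= N%:Z + 1 -> c%:Z <= B - A), c%:Z <= B - A &
    (1 <= A -> (A <= N%:Z + 1 -> N%:Z + 1 <= B -> c%:Z = N%:Z + 1 - A) /\
               (B <= N%:Z + 1 -> c%:Z = B - A))].
Proof.
move=> AB; rewrite {}/c; elim: N => [|N [IH1 IH2 IH3 IH4 IH5]].
  by rewrite big_geq //; split; lia.
rewrite big_nat_recr //=; move: IH1 IH2 IH3 IH4 IH5; set c := (\sum_(1 <= n < N.+1) _)%N.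
move=> IH1 IH2 IH3 IH4 IH5.
by split; [| | | |move=> A1; have [] := IH5 A1; split]; lia.
Qed.

(** * Beatty sequences: regrouping by value *)

Section BeattySums.
Variables (R : realType) (alpha beta : R).
Hypothesis alpha_gt0 : 0 < alpha.

Definition beatty_count (N m : nat) : nat :=
  (\sum_(1 <= n < N.+1) nat_of_bool (Num.floor (alpha * n%:R + beta) == m%:Z))%N.

(** The number of all integers n with floor (alpha n + beta) = m, that is of n in [(m - beta) /
    alpha, (m + 1 - beta) / alpha): a difference of two floors, written so that the length 1 / alpha
    stands apart. *)
Definition beatty_density (m : nat) : R :=
  alpha^-1 + frac (- alpha^-1 * m%:R + (beta - 1) / alpha)
  - frac (- alpha^-1 * m%:R + beta / alpha).

(** Restricting n to 1, ..., N can only lower the count, which is between 0 and the density in any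
    case. For m > beta the interval of n starts at 1 or later, and m + 1 <= alpha N + beta keeps it
    within N, so nothing is lost. *)
Lemma beatty_count_spec (N m : nat) :
  `|(beatty_count N m)%:R - beatty_density m| <= alpha^-1 + 1 /\
  (beta < m%:R -> m%:R + 1 <= alpha * N%:R + beta ->
   (beatty_count N m)%:R = beatty_density m).
Proof.
have an : alpha != 0 by rewrite gt_eqF.
have ai : 0 < alpha^-1 by rewrite invr_gt0.
pose x1 := - alpha^-1 * m%:R + beta / alpha.
pose x2 := - alpha^-1 * m%:R + (beta - 1) / alpha.
have x12 : x1 = x2 + alpha^-1 by rewrite /x1 /x2; field.
pose A : int := - Num.floor x1; pose B : int := - Num.floor x2.
have AB : A <= B by rewrite lerN2; apply: le_floor; rewrite x12 lerDl ltW.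
have cE : beatty_count N m = (\sum_(1 <= n < N.+1) nat_of_bool ((A <= n%:Z) && (n%:Z < B))%R)%N.
  apply: eq_big_nat => n _; congr nat_of_bool.
  rewrite floor_eq; congr (_ && _).
    rewrite /A lerNl floor_ge_int mulrNz /x1.
    rewrite -[RHS](ler_pM2l alpha_gt0) mulrDr mulrN mulrA mulrN mulfV // mulN1r mulrCA mulfV // mulr1.
    by apply/idP/idP; lra.
  rewrite /B ltrNr floor_lt_int mulrNz intrD /x2.
  rewrite -[RHS](ltr_pM2l alpha_gt0) mulrDr mulrN mulrA mulrN mulfV // mulN1r mulrCA mulfV // mulr1.
  by apply/idP/idP; lra.
have dE : beatty_density m = (B - A)%:~R.
  rewrite /beatty_density -/x1 -/x2 /frac /A /B intrD !mulrNz opprK x12; ring.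
have [_ _ _ c_le c_eq] := count_interval N AB.
rewrite -cE in c_le c_eq.
have cle : (beatty_count N m)%:R <= beatty_density m.
  by rewrite dE -[X in X <= _]/((beatty_count N m)%:Z%:~R) ler_int.
split.
  have /andP[f1 f2] := frac_itv x1; have /andP[f3 f4] := frac_itv x2.
  have dd : beatty_density m <= alpha^-1 + 1 by rewrite /beatty_density -/x1 -/x2; lra.
  have c0 : (0 : R) <= (beatty_count N m)%:R by [].
  by rewrite ler_norml; apply/andP; split; lra.
move=> bm mN; rewrite dE -[LHS]/((beatty_count N m)%:Z%:~R); congr (_%:~R).
have A1 : 1 <= A.
  have : Num.floor x1 < 0.
    rewrite floor_lt0; have -> : x1 = (beta - m%:R) / alpha by rewrite /x1; ring.
    by rewrite pmulr_llt0 // subr_lt0.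
  by rewrite /A; lia.
have [_] := c_eq A1; apply.
have : - N%:Z <= Num.floor x2.
  rewrite floor_ge_int mulrNz; have -> : x2 = (beta - 1 - m%:R) / alpha by rewrite /x2; ring.
  by rewrite ler_pdivlMr //; lra.
by rewrite /B; lia.
Qed.

Variables (a q : nat).
Definition residue_weight (m : nat) : R := if m == a %[mod q] then Lam R m else 0.

Lemma residue_weight_ge0 m : 0 <= residue_weight m.
Proof. by rewrite /residue_weight; case: ifP => // _; exact: Lam_ge0. Qed.

Lemma residue_weight_le m : residue_weight m <= Lam R m.
Proof. by rewrite /residue_weight; case: ifP => // _; exact: Lam_ge0. Qed.

(** Values of the floor that are 0 or negative have weight 0, and no value exceeds [M], because the
    floor increases with n. *)
Lemma beatty_sum_regroup (N : nat) (M := Num.truncn (alpha * N%:R + beta)) :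
  \sum_(1 <= n < N.+1 | (Num.floor (alpha * n%:R + beta) == a%:Z %[mod q%:Z])%Z)
     vonMangoldt R (Num.floor (alpha * n%:R + beta)) =
  \sum_(1 <= m < M.+1) residue_weight m * (beatty_count N m)%:R.
Proof.
under [RHS]eq_bigr => m _ do rewrite /beatty_count natr_sum big_distrr /=.
rewrite exchange_big /= big_mkcond; apply: eq_big_nat => n /andP[n0 nN].
set y := Num.floor _.
have Lam0 : Lam R 0 = 0.
  by apply/eqP; rewrite eq_le Lam_ge0 andbT (le_trans (Lam_le_ln _ _)) // ln0.
have [[k yk]|[k yk]] : (exists k : nat, y = k%:Z) \/ (exists k, y = Negz k).
- by case: y => k; [left|right]; exists k.
- rewrite yk; have -> : (k%:Z == a%:Z %[mod q%:Z])%Z = (k == a %[mod q]).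
    by rewrite !modz_nat eqz_nat.
  rewrite -/(residue_weight k).
  transitivity (\sum_(1 <= m < M.+1 | m == k) residue_weight m).
    rewrite big_nat1_eq; case: ifP => // /negbT hk.
    have [k0|k0] := posnP k; first by rewrite k0 /residue_weight Lam0 if_same.
    move: hk; rewrite k0 /= ltnS -ltnNge => Mk.
    have yx : k%:R <= alpha * n%:R + beta.
      by have := floor_le (alpha * n%:R + beta); rewrite -/y yk.
    have nN' : alpha * n%:R + beta <= alpha * N%:R + beta.
      by rewrite lerD2r ler_pM2l // ler_nat -ltnS.
    have x0 : 0 <= alpha * N%:R + beta by apply: le_trans (le_trans yx nN').
    by move: Mk; rewrite ltnNge truncn_ge_nat // (le_trans yx nN').
  rewrite big_mkcond; apply: eq_bigr => m _; rewrite eqz_nat eq_sym.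
  by case: (k == m); rewrite ?mulr1 ?mulr0.
- rewrite yk /= if_same big1 // => m _.
  by rewrite mulr0.
Qed.

End BeattySums.

(** * Exponential sums over a residue class *)

Section ResidueExpSum.
Variable R : realType.

Lemma residue_exp_sum_bound (alpha : R) :
  0 < alpha -> irrational alpha -> finite_type alpha ->
  exists2 A : nat, (9 < A)%N & forall C1 : R, exists2 C : R, 0 <= C &
    forall P X M a q k : nat, (0 < P)%N -> (P ^ A <= X)%N -> X%:R <= C1 * P%:R ^+ A ->
      (M <= X)%N -> (0 < q <= P)%N -> (0 < k < P ^ 8)%N ->
      normc (\sum_(1 <= m < M.+1) (residue_weight R a q m)%:C *
        (expi (- alpha^-1) ^+ k) ^+ m) <= C * (X%:R / P%:R ^+ 9).
Proof.
move=> a0 irr ft; have [t [c c0 hc]] := finite_type_chord a0 irr ft.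
(* From k < [P ^ 8] and q <= [P], k n q is at most n [P ^ 9], whence [9 * t]; removing the q-th root
   of unity costs one more factor q <= [P]. *)
have [A A9 hA] := exp_sum_bound R t (9 * t + 1)%N 9.
exists A => // C1; have [C C0 hC] := hA c C1 c0.
exists C => // P X M a q k P0 PX XP MX /andP[q0 qP] /andP[k0 kP].
have p0 : (0 : R) < P%:R by rewrite ltr0n.
have -> : \sum_(1 <= m < M.+1) (residue_weight R a q m)%:C * (expi (- alpha^-1) ^+ k) ^+ m
  = \sum_(1 <= m < M.+1 | m == a %[mod q]) (Lam R m)%:C * (expi (- alpha^-1) ^+ k) ^+ m.
  rewrite [RHS]big_mkcond; apply: eq_bigr => m _; rewrite /residue_weight.
  by case: ifP => // _; rewrite mul0r.
apply: residue_exp_sum => // b; apply: hC => //.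
  by rewrite normcM !normcX !normc_expi !expr1n mulr1.
move=> n n0; pose z : R[i] := expi (q%:R^-1) ^+ b * expi (- alpha^-1) ^+ k; rewrite -/z.
have z1 : normc z = 1 by rewrite normcM !normcX !normc_expi !expr1n mulr1.
have znq : (z ^+ n) ^+ q = expi (- alpha^-1) ^+ (k * n * q).
  rewrite -exprM /z exprMn -!exprM.
  have -> : (b * (n * q) = q * (b * n))%N by lia.
  by rewrite exprM expi_inv_pow // expr1n mul1r mulnA.
have h1 := hc (k * n * q)%N; rewrite !muln_gt0 k0 n0 q0 in h1.
have {}h1 := h1 isT; rewrite -znq in h1.
have h2 : normc (1 - (z ^+ n) ^+ q) <= q%:R * normc (1 - z ^+ n).
  by apply: normc_expB1_le; rewrite normcX z1 expr1n.
have knq : ((k * n * q)%:R : R) <= n%:R * P%:R ^+ 9.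
  rewrite -natrX -natrM ler_nat mulnAC mulnC leq_mul2l.
  by rewrite (_ : 9 = 8 + 1)%N // expnD expn1 leq_mul ?orbT // ltnW.
have knq0 : (0 : R) < (k * n * q)%:R by rewrite ltr0n !muln_gt0 k0 n0.
have qp : (0 : R) < q%:R by rewrite ltr0n.
have h3 : c / (n%:R * P%:R ^+ 9) ^+ t <= q%:R * normc (1 - z ^+ n).
  apply: le_trans h2; apply: le_trans h1; rewrite ler_wpM2l ?(ltW c0) //.
  have nP0 : (0 : R) < n%:R * P%:R ^+ 9 by rewrite mulr_gt0 ?exprn_gt0 ?ltr0n.
  rewrite lef_pV2 ?posrE ?(exprn_gt0 _ knq0) ?(exprn_gt0 _ nP0) //.
  by rewrite lerXn2r ?nnegrE ?mulr_ge0 ?exprn_ge0.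
rewrite exprD exprM expr1 mulrA -exprMn invfM mulrA ler_pdivrMr // [leRHS]mulrC.
by apply: le_trans h3 _; rewrite ler_wpM2r ?normc_ge0 // ler_nat.
Qed.

End ResidueExpSum.

(** * Choice of parameters and conclusion *)

Lemma floor_root (R : realType) (N A : nat) (kappa := (A%:R)^-1 : R)
    (P := Num.truncn ((N%:R : R) `^ kappa)) : (0 < A)%N -> (0 < N)%N ->
  [/\ (0 < P)%N, (P ^ A <= N)%N, (N <= 2 ^ A * P ^ A)%N &
      (N%:R : R) / P%:R <= 2 * N%:R `^ (1 - kappa)].
Proof.
move=> A0 N0; have n0 : (0 : R) < N%:R by rewrite ltr0n.
have Ap : (0 : R) < A%:R by rewrite ltr0n.
pose x : R := N%:R `^ kappa.
have x0 : 0 < x by exact: powR_gt0.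
have x1 : 1 <= x.
  rewrite -[X in X <= _](powRr0 (N%:R : R)) ler_powR ?ler1n //.
  by rewrite invr_ge0 ltW.
have xA : x ^+ A = N%:R.
  by rewrite -powR_mulrn ?ltW // -powRrM mulVf ?gt_eqF // powRr1 // ltW.
have P0 : (0 < P)%N by rewrite truncn_gt0.
have /andP[Px xP] := truncn_itv (ltW x0); rewrite -/P in Px xP.
have p0 : (0 : R) < P%:R by rewrite ltr0n.
have x2P : x <= 2 * P%:R.
  have p1 : (1 : R) <= P%:R by rewrite ler1n.
  by apply: le_trans (ltW xP) _; rewrite -natr1; lra.
split=> //.
- by rewrite -(ler_nat R) natrX -xA lerXn2r ?nnegrE // ltW.
- rewrite -expnMn -(ler_nat R) natrX natrM -xA lerXn2r ?nnegrE ?mulr_ge0 //.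
  exact: ltW.
have e : N%:R `^ (1 - kappa) = N%:R / x.
  by rewrite powRB ?powRr1 ?(ltW n0) // (gt_eqF n0) implybT.
rewrite e ler_pdivrMr // mulrAC mulrA ler_pdivlMr //.
by rewrite [leRHS](_ : _ = N%:R * (2 * P%:R)) ?ler_wpM2l //; ring.
Qed.


Unset Implicit Arguments.
Local Close Scope complex_scope.

(* Num.truncn x is the floor of x for x >= 0 and is 0 for x < 0, so that the
   sum over m is empty when the floor of alpha * N + beta is not positive. *)
Theorem theorem5p4 (R : realType) (alpha beta : R)
  (alpha_gt0 : 0 < alpha)
  (alpha_irr : irrational alpha)
  (alpha_ft : finite_type alpha) :
  exists2 kappa : R, 0 < kappa & exists C : R,
    forall (N a q : nat),
      (1 <= N)%N -> (a < q)%N -> q%:R <= (N%:R : R) `^ kappa -> coprime a q ->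
      `| \sum_(1 <= n < N.+1 |
               (Num.floor (alpha * n%:R + beta) == a%:Z %[mod q%:Z])%Z)
            vonMangoldt R (Num.floor (alpha * n%:R + beta))
         - alpha^-1 *
           \sum_(1 <= m < (Num.truncn (alpha * N%:R + beta)).+1 |
                 (m%:Z == a%:Z %[mod q%:Z])%Z)
              vonMangoldt R m%:Z |
      <= C * N%:R `^ (1 - kappa).
Proof.
have [A A9 hA] := residue_exp_sum_bound alpha_gt0 alpha_irr alpha_ft.
have A0 : (0 < A)%N by apply: leq_trans A9.
exists (A%:R)^-1; first by rewrite invr_gt0 ltr0n.
(* With this factor [X = C0 * N] bounds both [N] and [M], and it stays comparable to [P ^ A]. *)
pose C0 := (Num.truncn (alpha + `|beta|)).+1.
have C0_gt : alpha + `|beta| < C0%:R by exact: truncnS_gt.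
pose C1 : R := (C0 * 2 ^ A)%:R.
have [C Cge0 hC] := hA C1.
pose C4 : R := 256 * (1 + `|ln C1| + A%:R) ^+ 4.
have C40 : 0 <= C4 by rewrite mulr_ge0 // exprn_ge0 // !addr_ge0.
have ai : 0 < alpha^-1 by rewrite invr_gt0.
pose b0 := (Num.truncn `|beta|).+1.
pose K := (alpha^-1 + 1) * (b0%:R + 2).
have K0 : 0 <= K by rewrite mulr_ge0 // addr_ge0 // ltW.
exists ((13 * C4 + 2 * C + K * C4) * (C0%:R * 2)).
move=> N a q N0 aq qN _.
have [P0 PN NP NPe] := floor_root R A0 N0.
set P := Num.truncn _ in P0 PN NP NPe.
have q0 : (0 < q)%N by apply: leq_ltn_trans aq.
have qP : (q <= P)%N by rewrite truncn_ge_nat // powR_ge0.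
pose X := (C0 * N)%N.
have NX : (N <= X)%N by rewrite leq_pmull.
have PX : (P ^ A <= X)%N by apply: leq_trans PN NX.
have X0 : (0 < X)%N by rewrite muln_gt0.
have XP : X%:R <= C1 * P%:R ^+ A.
  by rewrite /C1 -natrX -natrM ler_nat /X -mulnA leq_mul2l NP orbT.
pose M := Num.truncn (alpha * N%:R + beta).
have n1 : (1 : R) <= N%:R by rewrite ler1n.
have MX : (M <= X)%N.
  have h : alpha * N%:R + beta < X%:R.
    rewrite /X natrM; apply: (@le_lt_trans _ _ ((alpha + `|beta|) * N%:R)).
      rewrite mulrDl lerD2l; apply: le_trans (ler_norm _) _.
      by rewrite ler_peMr.
    by rewrite ltr_pM2r // (lt_le_trans ltr01).
  have [x0|x0] := leP 0 (alpha * N%:R + beta).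
    by rewrite ltnW // -(ltr_nat R) (le_lt_trans _ h) // truncn_le.
  rewrite /M (_ : Num.truncn _ = 0%N) //; apply/truncn0Pn; rewrite -ltNge.
  by apply: lt_trans x0 ltr01.
have p0 : (0 : R) < P%:R by rewrite ltr0n.
have p1 : (1 : R) <= P%:R by rewrite ler1n.
have lnX0 : 0 <= ln (X%:R : R) := ln_nat_ge0 R X.
have lnX : ln X%:R <= C4 * P%:R.
  apply: le_trans (log_fourth_bound P0 X0 XP).
  by apply: (@le_trans _ _ (1 + ln X%:R)); [rewrite lerDr|rewrite ler_eXnr // lerDl].
pose w := residue_weight R a q.
pose W : R := \sum_(1 <= m < M.+1) w m.
have w_le m : (m <= X)%N -> w m <= ln X%:R.
  move=> mX; apply: le_trans (residue_weight_le _ _ _ _) _.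
  by apply: le_trans (Lam_le_ln _ _) _; exact: ler_ln_nat.
have w_ge0 m : 0 <= w m by exact: residue_weight_ge0.
have W_ge0 : 0 <= W by apply: sumr_ge0.
have W_le : W <= X%:R * ln X%:R.
  apply: (@le_trans _ _ (\sum_(1 <= m < M.+1) ln (X%:R : R))).
    apply: ler_sum_nat => m /andP[_ mM]; apply: w_le.
    by apply: leq_trans MX; rewrite -ltnS.
  by rewrite sumr_const_nat subSS subn0 -[leLHS]mulr_natl ler_wpM2r // ler_nat.
rewrite (beatty_sum_regroup beta alpha_gt0) -/M.
have -> : \sum_(1 <= m < M.+1 | (m%:Z == a%:Z %[mod q%:Z])%Z) vonMangoldt R m%:Z = W.
  rewrite big_mkcond; apply: eq_bigr => m _.
  by rewrite !modz_nat eqz_nat /w /residue_weight /Lam.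
pose g : R := - alpha^-1.
pose E : R := C * (X%:R / P%:R ^+ 9).
have E0 : 0 <= E by rewrite mulr_ge0 // divr_ge0 // exprn_ge0.
(* Here d = P ^ 2, e = P ^ 6 and eps = P ^- 4, which balances eps against 4 / (P ^ 8 eps). Every
   multiple of [W] is then of order P ^- 2, with total constant 3 + 2 (1 + 4) = 13; one of the two
   powers of [P] pays for the logarithm in [W]. *)
pose B : R := W * (3 / (P ^ 2)%:R) +
  2 * (W * ((P ^ 2)%:R * ((P%:R ^+ 4)^-1 + 4 / ((P ^ 2 * P ^ 6)%:R * (P%:R ^+ 4)^-1)))
       + (P ^ 2 * P ^ 6)%:R * E).
have disc s s' : \sum_(1 <= m < M.+1) w m * frac (g * m%:R + s)
    - \sum_(1 <= m < M.+1) w m * frac (g * m%:R + s') <= B.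
  apply: (@frac_sum_discrepancy R nat (index_iota 1 M.+1) w (fun m => g * m%:R)) => //.
  - by rewrite expn_gt0 P0.
  - by rewrite expn_gt0 P0.
  - by rewrite invr_gt0 exprn_gt0.
  move=> k; rewrite -expnD => hk; apply: le_trans (hC P X M a q k _ _ _ _ _ _) => //.
    under eq_bigr => m _ do rewrite expi_mulrn exprAC.
    exact: lexx.
  by rewrite q0.
have B_le : B <= (13 * C4 + 2 * C) * (X%:R / P%:R).
  have pn : (P%:R : R) != 0 by rewrite gt_eqF.
  have -> : B = 13 * (W / P%:R ^+ 2) + 2 * C * (X%:R / P%:R).
    by rewrite /B /E natrM !natrX; field.
  have WP : W / P%:R ^+ 2 <= C4 * (X%:R / P%:R).
    rewrite ler_pdivrMr ?exprn_gt0 //; apply: le_trans W_le _.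
    have -> : C4 * (X%:R / P%:R) * P%:R ^+ 2 = X%:R * (C4 * P%:R) by field.
    by rewrite ler_wpM2l.
  by move: WP; rewrite mulrDl; lra.
(* Boundary values: m <= b0 may fail to exceed beta, and for m = M the interval of n may reach
   beyond N. *)
pose bad m := ((m <= b0) + (m == M))%N.
have dev m : (1 <= m < M.+1)%N ->
    `|w m * ((beatty_count alpha beta N m)%:R - beatty_density alpha beta m)|
    <= ln X%:R * ((alpha^-1 + 1) * (bad m)%:R).
  move=> /andP[m0 mM]; rewrite normrM (ger0_norm (w_ge0 m)).
  have mX : (m <= X)%N by apply: leq_trans MX; rewrite -ltnS.
  apply: ler_pM => //; first exact: w_le.
  have [hd heq] := beatty_count_spec beta alpha_gt0 N m.
  have [bad0|bad0] := posnP (bad m).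
    have [bm Mm] : (b0 < m)%N /\ m != M.
      by move: bad0; rewrite /bad; case: leqP => //; case: eqVneq.
    rewrite bad0 mulr0 heq ?subrr ?normr0 //.
      apply: le_lt_trans (ler_norm _) _; apply: lt_trans (truncnS_gt _) _.
      by rewrite ltr_nat.
    have mM' : (m < M)%N by rewrite ltn_neqAle Mm -ltnS.
    have M1 : 1 <= alpha * N%:R + beta by rewrite -truncn_gt0 (leq_ltn_trans _ mM').
    apply: (@le_trans _ _ M%:R); first by rewrite natr1 ler_nat.
    by rewrite truncn_le (le_trans ler01).
  apply: le_trans hd _; rewrite ler_peMr ?ler1n //.
  by rewrite addr_ge0 // ltW.
have -> : \sum_(1 <= m < M.+1) residue_weight R a q m * (beatty_count alpha beta N m)%:R
    - alpha^-1 * W =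
  \sum_(1 <= m < M.+1) w m * ((beatty_count alpha beta N m)%:R - beatty_density alpha beta m)
  + (\sum_(1 <= m < M.+1) w m * frac (g * m%:R + (beta - 1) / alpha)
     - \sum_(1 <= m < M.+1) w m * frac (g * m%:R + beta / alpha)).
  rewrite /W big_distrr /= -!sumrB -big_split /=; apply: eq_bigr => m _.
  by rewrite /beatty_density -/g -/(w m); ring.
apply: le_trans (ler_normD _ _) _.
have dev_sum : `|\sum_(1 <= m < M.+1) w m *
     ((beatty_count alpha beta N m)%:R - beatty_density alpha beta m)|
    <= K * C4 * (X%:R / P%:R).
  apply: le_trans (ler_norm_sum _ _ _) _.
  apply: le_trans (ler_sum_nat dev) _.
  rewrite -!big_distrr -natr_sum /=.
  (* Adjoining the index 0 leaves at most b0 + 1 values for the first condition, and the second adds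
     one. *)
  have bad_sum : (\sum_(1 <= m < M.+1) bad m <= b0 + 2)%N.
    rewrite big_split /= (_ : b0 + 2 = b0.+1 + 1)%N; last by rewrite addn2 addn1.
    apply: leq_add.
      apply: (@leq_trans (\sum_(0 <= m < M.+1) nat_of_bool (m <= b0))%N).
        by rewrite [X in (_ <= X)%N]big_ltn // leq_addl.
      by rewrite count_low geq_minr.
    rewrite (eq_bigr (fun m => if m == M then 1%N else 0%N)) => [|m _]; last by case: eqP.
    by rewrite -big_mkcond big_nat1_eq; case: ifP.
  apply: (@le_trans _ _ (ln X%:R * K)).
    rewrite ler_wpM2l // /K ler_wpM2l ?addr_ge0 ?(ltW ai) //.
    by rewrite -natrD ler_nat.
  rewrite mulrC -mulrA; apply: ler_wpM2l => //; apply: le_trans lnX _.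
  apply: ler_wpM2l => //; rewrite ler_pdivlMr // -natrM ler_nat mulnn.
  by apply: leq_trans PX; rewrite leq_pexp2l // (leq_trans _ A9).
have disc_abs : `|\sum_(1 <= m < M.+1) w m * frac (g * m%:R + (beta - 1) / alpha)
     - \sum_(1 <= m < M.+1) w m * frac (g * m%:R + beta / alpha)|
   <= (13 * C4 + 2 * C) * (X%:R / P%:R).
  apply: le_trans B_le; rewrite ler_norml disc andbT lerNl opprB; exact: disc.
apply: le_trans (lerD dev_sum disc_abs) _.
have XPE : X%:R / P%:R <= (C0%:R * 2) * N%:R `^ (1 - (A%:R)^-1) :> R.
  by rewrite /X natrM -!mulrA ler_wpM2l // mulrA.
rewrite -mulrDl addrC -[leRHS]mulrA; apply: ler_wpM2l XPE.
by apply: addr_ge0; [apply: addr_ge0|]; apply: mulr_ge0.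
Qed.
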